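(* Let $P_1$ and $P_2$ be real constant coefficient ordinary differential operators of orders $n_1\ge2$ and $n_2\ge2$, and let $\Sigma(t_1,t_2)=\sigma_1(t_1)\otimes\sigma_2(t_2)$ be the associated surface in $\mathbb{R}^{n_1n_2}$. If the roots of the characteristic polynomials $\mathcal{P}_1$ and $\mathcal{P}_2$ are real and simple, and if the real roots are dominant, then $$|K|[\Sigma]\le 2\pi+4n_1(n_1-1)+4n_2(n_2-1)\,,$$ where $|K|[\Sigma]:=\int_\Sigma|K|\,\mathrm{dvol}$ is the integral over $\Sigma$ of the absolute value of the Gauss curvature $K$.
   Context: For $i=1,2$, $P_i$ is a real constant coefficient ordinary differential operator (with leading coefficient $1$) of order $n_i\ge2$ with characteristic polynomial $\mathcal{P}_i$. When the roots of $\mathcal{P}_1$ and $\mathcal{P}_2$ are real and simple, list them as $r_1>\dots>r_{n_1}$ and $s_1>\dots>s_{n_2}$. ''The real roots are dominant'' then means $r_1>0>r_{n_1}$ and $s_1>0>s_{n_2}$. The associated curves are $\sigma_1(t_1)=(e^{r_1t_1},\dots,e^{r_{n_1}t_1})$ and $\sigma_2(t_2)=(e^{s_1t_2},\dots,e^{s_{n_2}t_2})$, and $\Sigma:\mathbb{R}^2\to\mathbb{R}^{n_1n_2}$ is $\Sigma(t_1,t_2)=\sigma_1(t_1)\otimes\sigma_2(t_2)$, i.e. its coordinates are $e^{r_it_1+s_jt_2}$ for $1\le i\le n_1$, $1\le j\le n_2$; $\mathbb{R}^{n_1n_2}$ carries the standard Euclidean inner product $(\cdot,\cdot)$. $K$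 is the Gauss curvature of the metric induced on $\Sigma$, with components $g_{ij}=(\partial_{t_i}\Sigma,\partial_{t_j}\Sigma)$, and $\mathrm{dvol}=g\,dt_1dt_2$ with $g=\sqrt{g_{11}g_{22}-g_{12}^2}$, so that $|K|[\Sigma]=\int_{\mathbb{R}^2}|K|\,g\,dt_1dt_2$. *)

(* Defs.v *)
From HB Require Import structures.
From mathcomp Require Import all_boot all_order all_algebra.
From mathcomp Require Import complex.
From mathcomp Require Import all_classical all_reals all_analysis.

Set Implicit Arguments.
Unset Strict Implicit.
Unset Printing Implicit Defensive.

Import Order.TTheory GRing.Theory Num.Theory.
Import numFieldNormedType.Exports.

Local Open Scope classical_set_scope.
Local Open Scope ring_scope.

(* [lower_coef P k] is the coefficient of the k-th derivative, k < n; the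
   coefficient of the n-th derivative is 1. *)
Record diffop (R : Type) (n : nat) := DiffOp { lower_coef : 'I_n -> R }.

Definition diffop_apply (R : realType) (n : nat) (P : diffop R n)
    (f : R -> R) (t : R) : R :=
  derive1n n f t + \sum_(k < n) lower_coef P k * derive1n k f t.

Definition charpoly (R : realType) (n : nat) (P : diffop R n) : {poly R} :=
  'X^n + \sum_(k < n) lower_coef P k *: 'X^k.

Definition complex_poly (R : realType) (p : {poly R}) : {poly R[i]} :=
  map_poly (real_complex R) p.

Definition roots_real (R : realType) (p : {poly R}) : Prop :=
  forall z : R[i], root (complex_poly p) z -> complex.Im z = 0.

Definition roots_simple (R : realType) (p : {poly R}) : Prop :=
  forall z : R[i], root (complex_poly p) z -> mup z (complex_poly p) = 1%N.

Definition decreasing_listing (R : realType) (n : nat) (p : {poly R})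
    (r : n.-tuple R) : Prop :=
  sorted >%R r /\ (forall x : R, root p x = (x \in r)).

(* For a decreasing list of n >= 1 roots. *)
Definition real_roots_dominant (R : realType) (n : nat) (r : n.-tuple R) :
    Prop :=
  r`_0 > 0 /\ 0 > r`_n.-1.

Definition exp_curve (R : realType) (n : nat) (r : n.-tuple R) (t : R) :
    'rV[R]_n :=
  \row_i expR (tnth r i * t).

(* R^m (x) R^n is identified with R^(m * n) through [mxvec_index]. *)
Definition tensor (R : realType) (m n : nat) (u : 'rV[R]_m) (v : 'rV[R]_n) :
    'rV[R]_(m * n) :=
  mxvec (\matrix_(i, j) (u 0 i * v 0 j)).

Definition tensor_surface (R : realType) (n1 n2 : nat)
    (r : n1.-tuple R) (s : n2.-tuple R) (t : R * R) : 'rV[R]_(n1 * n2) :=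
  tensor (exp_curve r t.1) (exp_curve s t.2).

Definition dotprod (R : realType) (N : nat) (u v : 'rV[R]_N) : R :=
  \sum_k u 0 k * v 0 k.

Definition partial (R : realType) (V : normedModType R) (i : 'I_2)
    (f : R * R -> V) (t : R * R) : V :=
  if i == 0 then derive1 (fun x : R => f (x, t.2)) t.1
  else derive1 (fun y : R => f (t.1, y)) t.2.

Definition induced_metric (R : realType) (N : nat) (S : R * R -> 'rV[R]_N)
    (t : R * R) : 'M[R]_2 :=
  \matrix_(i, j) dotprod (partial i S t) (partial j S t).

Section Curvature.
Context (R : realType) (G : R * R -> 'M[R]_2).

Definition vol_density (t : R * R) : R :=
  Num.sqrt (G t 0 0 * G t 1 1 - G t 0 1 ^+ 2).

(* [christoffel k i j] is the Christoffel symbol of the second kind with upper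
   index k and lower indices i, j. *)
Definition christoffel (k i j : 'I_2) (t : R * R) : R :=
  2^-1 * \sum_l invmx (G t) k l *
    (partial i (fun u => G u j l) t + partial j (fun u => G u i l) t
     - partial l (fun u => G u i j) t).

(* R(d_i, d_j) d_k = \sum_l riemann l k i j *: d_l, with the sign convention
   R(X, Y) = [nabla_X, nabla_Y] - nabla_[X, Y]. *)
Definition riemann (l k i j : 'I_2) (t : R * R) : R :=
  partial i (christoffel l j k) t - partial j (christoffel l i k) t
  + \sum_m (christoffel l i m t * christoffel m j k t
            - christoffel l j m t * christoffel m i k t).

(* (R(d_0, d_1) d_1, d_0) / (g_00 g_11 - g_01^2) *)
Definition gauss_curvature (t : R * R) : R :=
  (\sum_l riemann l 1 0 1 t * G t l 0)
  / (G t 0 0 * G t 1 1 - G t 0 1 ^+ 2).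

End Curvature.

Definition total_abs_curvature (R : realType) (N : nat)
    (S : R * R -> 'rV[R]_N) : \bar R :=
  (\int[(@lebesgue_measure R) \x (@lebesgue_measure R)]_t
     (`|gauss_curvature (induced_metric S) t|
      * vol_density (induced_metric S) t)%:E)%E.

(* Main.v *)
Require Import Defs.
From mathcomp Require Import all_boot all_order all_algebra.
From mathcomp Require Import all_classical all_reals all_analysis.
From mathcomp Require Import measurable_realfun.
From mathcomp Require Import ring lra.

Import Order.TTheory GRing.Theory Num.Theory.
Import numFieldNormedType.Exports.

Local Open Scope classical_set_scope.
Local Open Scope ring_scope.

                                             

(** Let [a_k] and [b_k] be the k-th derivatives of the sums of [expR (2 * r_i * x)] and of
    [expR (2 * s_j * y)]; they are the values of [expsum] on the doubled roots. The induced metric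
    is one quarter of the Hessian of [a_0 x * b_0 y], so its curvature is an explicit rational
    function of the [a_k] and [b_k]. Put [D = a_0 a_2 - a_1^2], [E = b_0 b_2 - b_1^2] ([gram]) and
    [Q = a_0 a_2 b_0 b_2 - a_1^2 b_1^2] ([hessian_det]). Up to sign the curvature density is [(b_1
    E' (2 a_2 D - a_1 D') + a_1 D' (2 b_2 E - b_1 E')) / (8 Q^(3/2))], a sum of two terms exchanged
    by swapping the two curves.

    The first term factors. With [h^2 = b_0 b_2 / E >= 1] one has [Q = E (a_1^2 + h^2 D)], and the
    term equals half of [turning] in [y] times the [x]-derivative of
    [direction = a_1 / sqrt (a_1^2 + h^2 D)] ([normr_curvature_part]). By Tonelli two one-variable
    estimates suffice.

    [direction_variation]: for every [h >= 1] the total variation of [direction] is at most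
    [2 (n - 1 + ln n)]. On [t >= 0] its decrease is controlled in two regimes: where [a_1 >= 0] by
    the derivative of [top * t - ln a_0], whose gain is at most [ln n]; where [a_1 < 0] by one
    increasing function with values in [0, 1] for each non-extreme negative root. The half-line
    [t <= 0] is obtained by negating the roots.

    [turning_integral]: the integral of [|turning|] is at most [(n - 1) pi]. Here [turning] is twice
    the speed of the curve projected to the unit sphere minus the derivative of [position_angle].
    The spherical length is at most [(n - 1) pi / 2], [turning] changes sign at most twice because
    [a_1] and [D'] are both nondecreasing, and dominance of the real roots makes the angle go from
    [- pi / 2] to [pi / 2].

    Multiplying and adding, the total curvature is at most [(n1 - 1 + ln n1) (n2 - 1) pi + (n2 - 1 +
    ln n2) (n1 - 1) pi]. The estimates [ln n <= n / 5 + 1] and [pi <= 10 / 3] turn this into the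
    stated bound ([numeric_bound]). *)

(** * Calculus rules and integrals bounded by increments *)

Section DerivativeRules.
Context {R : realType}.
Implicit Types (f g : R -> R) (t : R).

Lemma is_derive_val {f t} {df dg : R} : is_derive t 1 f df -> df = dg ->
  is_derive t 1 f dg.
Proof. by move=> ? <-. Qed.

Lemma is_derive_cst1 (c t : R) : is_derive t 1 (fun _ => c) 0.
Proof. exact: is_derive_cst. Qed.

Lemma is_derive_add {f g t df dg} : is_derive t 1 f df -> is_derive t 1 g dg ->
  is_derive t 1 (fun x => f x + g x) (df + dg).
Proof. by move=> ? ?; exact: is_deriveD. Qed.

Lemma is_derive_opp {f t df} : is_derive t 1 f df ->
  is_derive t 1 (fun x => - f x) (- df).
Proof. by move=> ?; exact: is_deriveN. Qed.

Lemma is_derive_mul {f g t df dg} : is_derive t 1 f df -> is_derive t 1 g dg ->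
  is_derive t 1 (fun x => f x * g x) (df * g t + f t * dg).
Proof.
move=> hf hg; have h := is_deriveM hf hg.
by apply: (is_derive_val h); rewrite /GRing.scale /= addrC [g t * _]mulrC.
Qed.

Lemma is_derive_sqr {f t df} : is_derive t 1 f df ->
  is_derive t 1 (fun x => f x ^+ 2) (2 * f t * df).
Proof.
move=> hf; apply: (is_derive_val (is_derive_mul hf hf)); ring.
Qed.

Lemma is_derive_inv {f t df} : is_derive t 1 f df -> f t != 0 ->
  is_derive t 1 (fun x => (f x)^-1) (- df / f t ^+ 2).
Proof.
move=> hf ft; apply: (is_derive_val (@is_deriveV _ f t df 1 ft hf)).
by rewrite /GRing.scale /=; field.
Qed.

Lemma is_derive_sqrt {f t df} : is_derive t 1 f df -> 0 < f t ->
  is_derive t 1 (fun x => Num.sqrt (f x)) (df / (2 * Num.sqrt (f t))).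
Proof.
move=> hf ft; apply: (is_derive_val (@is_derive1_comp _ _ f _ _ _ (is_derive1_sqrt ft) hf)).
by rewrite mulrC.
Qed.

Lemma is_derive_ln {f t df} : is_derive t 1 f df -> 0 < f t ->
  is_derive t 1 (fun x => ln (f x)) (df / f t).
Proof.
move=> hf ft; apply: (is_derive_val (@is_derive1_comp _ _ f _ _ _ (is_derive1_ln ft) hf)).
by rewrite mulrC.
Qed.

Lemma is_derive_atan {f t df} : is_derive t 1 f df ->
  is_derive t 1 (fun x => atan (f x)) (df / (1 + f t ^+ 2)).
Proof.
move=> hf; apply: (is_derive_val (@is_derive1_comp _ _ f _ _ _ (is_derive1_atan _) hf)).
by rewrite mulrC.
Qed.

Lemma is_derive_exp (c t : R) :
  is_derive t 1 (fun x => expR (c * x)) (c * expR (c * t)).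
Proof.
have h := is_derive_mul (is_derive_cst1 c t) (is_derive_id t 1).
apply: (is_derive_val (@is_derive1_comp _ _ _ _ _ _ (is_derive_expR _) h)).
by rewrite mul0r add0r mulr1 mulrC.
Qed.

Lemma is_derive_bigsum (I : Type) (s : seq I) (P : pred I) (f df : I -> R -> R) t :
  (forall i, is_derive t 1 (f i) (df i t)) ->
  is_derive t 1 (fun x => \sum_(i <- s | P i) f i x) (\sum_(i <- s | P i) df i t).
Proof.
move=> h; elim: s => [|i s IH].
  under eq_fun do rewrite big_nil; rewrite big_nil; exact: is_derive_cst1.
under eq_fun do rewrite big_cons; rewrite big_cons; case: (P i) => //.
exact: is_derive_add.
Qed.

Lemma is_derive_continuous {f df} : (forall t, is_derive t 1 f (df t)) -> continuous f.
Proof.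
move=> h t; apply: differentiable_continuous; apply/derivable1_diffP.
by have [] := h t.
Qed.

Lemma derive_ge0_le f df u v : (forall t, is_derive t 1 f (df t)) ->
  (forall t, 0 <= df t) -> u <= v -> f u <= f v.
Proof.
move=> h h0; rewrite le_eqVlt => /orP[/eqP->//|uv].
have [|c _] := @MVT _ f df u v uv (fun x _ => h x).
  exact/continuous_subspaceT/(is_derive_continuous h).
by move=> e; rewrite -subr_ge0 e mulr_ge0// subr_ge0 ltW.
Qed.

End DerivativeRules.

Section ContinuityRules.
Context {R : realType}.
Implicit Types f g : R -> R.

Lemma continuous_cst1 (c : R) : continuous (fun _ : R => c).
Proof. by move=> t; exact: cvg_cst. Qed.

Lemma continuous_add f g : continuous f -> continuous g ->
  continuous (fun x => f x + g x).
Proof. by move=> cf cg t; exact: (cvgD (cf t) (cg t)). Qed.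

Lemma continuous_opp f : continuous f -> continuous (fun x => - f x).
Proof. by move=> cf t; exact: (cvgN (cf t)). Qed.

Lemma continuous_mul f g : continuous f -> continuous g ->
  continuous (fun x => f x * g x).
Proof. by move=> cf cg t; exact: (cvgM (cf t) (cg t)). Qed.

Lemma continuous_pow f n : continuous f -> continuous (fun x => f x ^+ n).
Proof.
move=> cf; elim: n => [|n IH]; first exact: continuous_cst1.
by under eq_fun do rewrite exprS; exact: continuous_mul.
Qed.

Lemma continuous_inv f : (forall t, f t != 0) -> continuous f ->
  continuous (fun x => (f x)^-1).
Proof. by move=> f0 cf t; exact: (cvgV (f0 t) (cf t)). Qed.

Lemma continuous_norm f : continuous f -> continuous (fun x => `|f x|).
Proof. by move=> cf t; exact: (cvg_norm (cf t)). Qed.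

Lemma continuous_sqrt f : continuous f -> continuous (fun x => Num.sqrt (f x)).
Proof. by move=> cf t; exact: (continuous_comp (cf t) (@sqrt_continuous R (f t))). Qed.

Lemma continuous_bigsum (I : Type) (s : seq I) (f : I -> R -> R) :
  (forall i, continuous (f i)) -> continuous (fun x => \sum_(i <- s) f i x).
Proof.
move=> cf; elim: s => [|i s IH].
  by under eq_fun do rewrite big_nil; exact: continuous_cst1.
by under eq_fun do rewrite big_cons; exact: continuous_add.
Qed.

End ContinuityRules.

Section IntegralBounds.
Context {R : realType}.
Local Notation mu := (@lebesgue_measure R).

(** The fundamental theorem of calculus applied to a majorant. The comparison is asked only on the
    open interval, since the majorants below may be available only strictly inside; the endpoints
    have measure zero. *)
Lemma integral_le_increment (f g G : R -> R) (u v : R) : u <= v ->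
  measurable_fun setT f -> (forall x : R, 0 <= f x) ->
  (forall x : R, is_derive x 1 G (g x)) -> continuous g ->
  (forall x : R, u < x < v -> f x <= g x) ->
  (\int[mu]_(x in `[u, v]) (f x)%:E <= (G v - G u)%:E)%E.
Proof.
move=> uv mf f0 dG cg fg.
move: uv; rewrite le_eqVlt => /orP[/eqP<-|uv].
  by rewrite set_itv1 integral_set1 subrr.
have cG := is_derive_continuous dG.
rewrite EFinB -(@continuous_FTC2 _ g G u v uv).
- rewrite !(@integral_itv_bndoo R u v _ true false); last 2 first.
  + apply/measurable_EFinP; apply: measurable_funTS.
    exact: continuous_measurable_fun.
  + exact/measurable_EFinP/measurable_funTS.
  apply: ge0_le_integral => //.
  + by move=> x _; rewrite lee_fin.
  + exact/measurable_EFinP/measurable_funTS.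
  + apply/measurable_EFinP; apply: measurable_funTS.
    exact: continuous_measurable_fun.
- exact: continuous_subspaceT.
- split.
  + by move=> x _; have [] := dG x.
  + by apply: cvg_at_right_filter; exact: cG.
  + by apply: cvg_at_left_filter; exact: cG.
- by move=> x _; rewrite derive1E; have [_ ] := dG x.
Qed.

Lemma integral_itv_split (f : R -> R) (u v w : R) : u <= v -> v <= w ->
  measurable_fun setT f -> (forall x : R, 0 <= f x) ->
  (\int[mu]_(x in `[u, w]) (f x)%:E =
   \int[mu]_(x in `[u, v]) (f x)%:E + \int[mu]_(x in `[v, w]) (f x)%:E)%E.
Proof.
move=> uv vw mf f0.
have mE A : measurable_fun A (fun x => (f x)%:E).
  exact/measurable_EFinP/measurable_funTS.
rewrite -(@integral_itv_obnd_cbnd _ v (BRight w)) //.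
rewrite -ge0_integral_setU //.
- congr (integral _ _ _); apply/seteqP; split => x /=; rewrite !in_itv /=.
    by move=> /andP[ux xw]; case: (leP x v) => h; [left|right]; rewrite ?ux ?xw ?h.
  by move=> [/andP[ux xv]|/andP[vx xw]]; [rewrite ux (le_trans xv)|
    rewrite xw andbT (le_trans uv (ltW vx))].
- exact: mE.
- by move=> x _; rewrite lee_fin.
- apply/disj_set2P/seteqP; split => // x [/=]; rewrite !in_itv /=.
  by move=> /andP[_ xv] /andP[vx _]; move: (le_lt_trans xv vx); rewrite ltxx.
Qed.

Lemma integral_setT_le (f : R -> R) (C : \bar R) :
  measurable_fun setT f -> (forall x : R, 0 <= f x) ->
  (forall T : R, 0 <= T -> (\int[mu]_(x in `[(- T)%R, T]) (f x)%:E <= C)%E) ->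
  (\int[mu]_x (f x)%:E <= C)%E.
Proof.
move=> mf f0 h.
pose F (n : nat) : set R := [set` `[- n%:R, n%:R]].
have ndF : nondecreasing_seq F.
  move=> m n mn; apply/subsetPset => x /=; rewrite /F /= !in_itv /= => /andP[a b].
  have mn' : m%:R <= n%:R :> R by rewrite ler_nat.
  by rewrite (le_trans b mn') (le_trans _ a) // lerN2.
have FT : \bigcup_n F n = [set: R] by rewrite /F (bigcup_itvT true false).
have hc := @ge0_nondecreasing_set_cvg_integral _ (measurableTypeR R) R F (EFin \o f) mu ndF.
rewrite -FT; set I := (X in (X <= _)%E).
have {}hc : (fun n => \int[mu]_(x in F n) (f x)%:E)%E @ \oo --> I.
  apply: hc => [i|i|i x _].
  - exact: measurable_itv.
  - exact/measurable_EFinP/measurable_funTS.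
  - by rewrite lee_fin.
rewrite -(cvg_lim _ hc) //; apply: lime_le; first exact: (cvgP _ hc).
by apply: nearW => n; exact: h.
Qed.

End IntegralBounds.

                         

(** * Exponential sums and their Gram determinants *)

Section ExponentialSums.
Context {R : realType}.
Implicit Types (s : seq R) (t l : R).

Lemma sumr_mem_ge (s : seq R) (f : R -> R) x :
  (forall y, 0 <= f y) -> x \in s -> f x <= \sum_(y <- s) f y.
Proof.
by move=> f0 xs; rewrite (big_rem x xs) /= lerDl sumr_ge0.
Qed.

Lemma sumr_mem2_ge (s : seq R) (f : R -> R) x y :
  (forall z, 0 <= f z) -> x \in s -> y \in s -> x != y ->
  f x + f y <= \sum_(z <- s) f z.
Proof.
move=> f0 xs ys xy; rewrite (big_rem x xs) /= lerD2l sumr_mem_ge //.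
by rewrite rem_mem // eq_sym.
Qed.

Definition expsum s k t := \sum_(l <- s) l ^+ k * expR (l * t).

(** For the doubled roots of an exponential curve this is four times the Gram determinant of the
    curve and its velocity. *)
Definition gram s t := expsum s 0 t * expsum s 2 t - expsum s 1 t ^+ 2.

Definition dgram s t := expsum s 0 t * expsum s 3 t - expsum s 1 t * expsum s 2 t.

Lemma is_derive_expsum s k t : is_derive t 1 (expsum s k) (expsum s k.+1 t).
Proof.
apply: (is_derive_bigsum _ s xpredT (fun l x => l ^+ k * expR (l * x))
  (fun l x => l ^+ k.+1 * expR (l * x))) => l.
apply: (is_derive_val (is_derive_mul (is_derive_cst1 _ _) (is_derive_exp l t))).
by rewrite mul0r add0r mulrA exprSr.
Qed.

Lemma continuous_expsum s k : continuous (expsum s k).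
Proof. exact: (is_derive_continuous (is_derive_expsum s k)). Qed.

Lemma expsum_even_ge0 s k t : ~~ odd k -> 0 <= expsum s k t.
Proof. by move=> k0; apply: sumr_ge0 => l _; rewrite mulr_ge0 ?expR_ge0 ?exprn_even_ge0. Qed.

Lemma expsum_even_gt0 s k t l : ~~ odd k -> l \in s -> l != 0 \/ k = 0%N ->
  0 < expsum s k t.
Proof.
move=> k0 ls h; apply: (@lt_le_trans _ _ (l ^+ k * expR (l * t))).
  by rewrite mulr_gt0 ?expR_gt0 // exprn_even_gt0 //; case: h => [->|->]; rewrite ?orbT.
rewrite /expsum; apply: (sumr_mem_ge s (fun l => l ^+ k * expR (l * t))) => // y.
by rewrite mulr_ge0 ?expR_ge0 ?exprn_even_ge0.
Qed.

Lemma expsumM s i j t : expsum s i t * expsum s j t =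
  \sum_(l <- s) \sum_(m <- s) l ^+ i * m ^+ j * expR ((l + m) * t).
Proof.
rewrite /expsum big_distrlr /=; apply: eq_bigr => l _; apply: eq_bigr => m _.
by rewrite mulrDl expRD; ring.
Qed.

                                                        
(** Lagrange's identity: symmetrizing the double sum turns the determinant into a sum of nonnegative
    terms over pairs of roots. *)
Lemma gramE s t : 2 * gram s t =
  \sum_(l <- s) \sum_(m <- s) (l - m) ^+ 2 * expR ((l + m) * t).
Proof.
have -> : 2 * gram s t = expsum s 0 t * expsum s 2 t + expsum s 2 t * expsum s 0 t
    + (- 2) * (expsum s 1 t * expsum s 1 t) by rewrite /gram; ring.
rewrite !expsumM big_distrr /= -!big_split /=; apply: eq_bigr => l _.
rewrite big_distrr /= -!big_split /=; apply: eq_bigr => m _; ring.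
Qed.

Lemma dgramE s t : 2 * dgram s t =
  \sum_(l <- s) \sum_(m <- s) (l - m) ^+ 2 * (l + m) * expR ((l + m) * t).
Proof.
have -> : 2 * dgram s t = expsum s 0 t * expsum s 3 t + expsum s 3 t * expsum s 0 t
    + (- 1) * (expsum s 1 t * expsum s 2 t) + (- 1) * (expsum s 2 t * expsum s 1 t)
  by rewrite /dgram; ring.
rewrite !expsumM 2!big_distrr /= -!big_split /=; apply: eq_bigr => l _.
rewrite 2!big_distrr /= -!big_split /=; apply: eq_bigr => m _; ring.
Qed.

Lemma gram_ge0 s t : 0 <= gram s t.
Proof.
rewrite -(@pmulr_rge0 _ 2) // gramE; apply: sumr_ge0 => l _.
by apply: sumr_ge0 => m _; rewrite mulr_ge0 ?sqr_ge0 ?expR_ge0.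
Qed.

Lemma gram_gt0 s t l m : l \in s -> m \in s -> l != m -> 0 < gram s t.
Proof.
move=> ls ms lm; rewrite -(@pmulr_rgt0 _ 2) // gramE.
have t0 x y : 0 <= (x - y) ^+ 2 * expR ((x + y) * t)
  by rewrite mulr_ge0 ?sqr_ge0 ?expR_ge0.
apply: (@lt_le_trans _ _ ((l - m) ^+ 2 * expR ((l + m) * t))).
  by rewrite mulr_gt0 ?expR_gt0 // exprn_even_gt0 //= subr_eq0.
apply: (le_trans (sumr_mem_ge s (fun m => (l - m) ^+ 2 * expR ((l + m) * t)) m _ _)) => //.
apply: (sumr_mem_ge s (fun l => \sum_(m <- s) (l - m) ^+ 2 * expR ((l + m) * t))) => // y.
exact: sumr_ge0.
Qed.

Lemma is_derive_gram s t : is_derive t 1 (gram s) (dgram s t).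
Proof.
apply: (is_derive_val (is_derive_add
  (is_derive_mul (is_derive_expsum s 0 t) (is_derive_expsum s 2 t))
  (is_derive_opp (is_derive_sqr (is_derive_expsum s 1 t))))).
rewrite /dgram; ring.
Qed.

Lemma is_derive_dgram s t : is_derive t 1 (dgram s)
  (expsum s 0 t * expsum s 4 t - expsum s 2 t ^+ 2).
Proof.
apply: (is_derive_val (is_derive_add
  (is_derive_mul (is_derive_expsum s 0 t) (is_derive_expsum s 3 t))
  (is_derive_opp (is_derive_mul (is_derive_expsum s 1 t) (is_derive_expsum s 2 t))))).
ring.
Qed.

(** Cauchy-Schwarz for the weights [expR (l * t)] and the functions 1 and [l ^+ 2]. Being the
    derivative of [dgram], this expression makes [dgram] monotone. *)
Lemma expsum04_ge s t : 0 <= expsum s 0 t * expsum s 4 t - expsum s 2 t ^+ 2.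
Proof.
rewrite -(@pmulr_rge0 _ 2) //.
have -> : 2 * (expsum s 0 t * expsum s 4 t - expsum s 2 t ^+ 2) =
    expsum s 0 t * expsum s 4 t + expsum s 4 t * expsum s 0 t
    + (- 2) * (expsum s 2 t * expsum s 2 t) by ring.
rewrite !expsumM big_distrr /= -!big_split /=; apply: sumr_ge0 => l _.
rewrite big_distrr /= -!big_split /=; apply: sumr_ge0 => m _.
rewrite (_ : _ + _ = (l ^+ 2 - m ^+ 2) ^+ 2 * expR ((l + m) * t)); last by ring.
by rewrite mulr_ge0 ?sqr_ge0 ?expR_ge0.
Qed.

Lemma dgram_nondecreasing s u v : u <= v -> dgram s u <= dgram s v.
Proof.
by apply: (derive_ge0_le _ _ _ _ (is_derive_dgram s)) => t; exact: expsum04_ge.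
Qed.

Lemma expsum1_nondecreasing s u v : u <= v -> expsum s 1 u <= expsum s 1 v.
Proof.
by apply: (derive_ge0_le _ _ _ _ (is_derive_expsum s 1)) => t; exact: expsum_even_ge0.
Qed.

(** Negating the roots reverses time, so every estimate on [t >= 0] also serves for [t <= 0]. *)
Lemma expsum_opp s k t : expsum (map -%R s) k t = (-1) ^+ k * expsum s k (- t).
Proof.
rewrite /expsum big_map big_distrr /=; apply: eq_bigr => l _.
rewrite (_ : - l * t = l * - t); last by rewrite mulrN mulNr.
by rewrite [(- l) ^+ k]exprNn mulrA.
Qed.

Lemma gram_opp s t : gram (map -%R s) t = gram s (- t).
Proof. by rewrite /gram !expsum_opp; ring. Qed.

Lemma dgram_opp s t : dgram (map -%R s) t = - dgram s (- t).
Proof. by rewrite /dgram !expsum_opp; ring. Qed.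

Lemma continuous_gram s : continuous (gram s).
Proof. exact: (is_derive_continuous (is_derive_gram s)). Qed.

Lemma continuous_dgram s : continuous (dgram s).
Proof. exact: (is_derive_continuous (is_derive_dgram s)). Qed.

End ExponentialSums.

                                   

(** * Total variation of the direction function, uniformly in the parameter [h] *)

Section Dominance.
Context {R : realType}.
Implicit Types (s : seq R) (t l h top bot : R).

Definition dominant_in s top bot : Prop :=
  [/\ top \in s, bot \in s, bot < 0 < top & forall l, l \in s -> bot <= l <= top].

Lemma dominant_in_opp s top bot : dominant_in s top bot ->
  dominant_in (map -%R s) (- bot) (- top).
Proof.
move=> [ts bs /andP[b0 t0] h]; split; rewrite ?map_f //.
  by rewrite oppr_lt0 t0 oppr_gt0 b0.
by move=> l /mapP[m /h/andP[a b] ->]; rewrite !lerN2 a b.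
Qed.

Section Fixed.
Variables (s : seq R) (top bot : R).
Hypothesis dom : dominant_in s top bot.

Lemma dominant_expsum0_gt0 t : 0 < expsum s 0 t.
Proof. by case: dom => ts _ _ _; apply: (expsum_even_gt0 _ _ _ top) => //; right. Qed.

Lemma dominant_expsum2_gt0 t : 0 < expsum s 2 t.
Proof.
case: dom => ts _ /andP[_ t0] _; apply: (expsum_even_gt0 _ _ _ top) => //; left.
by rewrite gt_eqF.
Qed.

Lemma dominant_gram_gt0 t : 0 < gram s t.
Proof.
case: dom => ts bs /andP[b0 t0] _; apply: (gram_gt0 _ _ _ _ ts bs).
by rewrite gt_eqF // (lt_trans b0).
Qed.

(** By [gramE] and [dgramE], the logarithmic derivative of [gram] is a weighted mean of the sums
    [l + m], hence lies between [2 * bot] and [2 * top]. *)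
Lemma dgram_le t : dgram s t <= 2 * top * gram s t.
Proof.
case: dom => _ _ _ h; rewrite -(@ler_pM2l _ 2) // dgramE mulrCA gramE mulr_sumr.
rewrite !big_seq; apply: ler_sum => l ls; rewrite mulr_sumr !big_seq.
apply: ler_sum => m ms; rewrite -subr_ge0.
rewrite [X in 0 <= X](_ : _ = (l - m) ^+ 2 * expR ((l + m) * t) * (2 * top - l - m)); last by ring.
apply: mulr_ge0; first by rewrite mulr_ge0 ?sqr_ge0 ?expR_ge0.
have /andP[l1 l2] := h _ ls; have /andP[m1 m2] := h _ ms; lra.
Qed.

Lemma dgram_ge t : 2 * bot * gram s t <= dgram s t.
Proof.
case: dom => _ _ _ h; rewrite -(@ler_pM2l _ 2) // dgramE mulrCA gramE mulr_sumr.
rewrite !big_seq; apply: ler_sum => l ls; rewrite mulr_sumr !big_seq.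
apply: ler_sum => m ms; rewrite -subr_ge0.
rewrite [X in 0 <= X](_ : _ = (l - m) ^+ 2 * expR ((l + m) * t) * (l + m - 2 * bot)); last by ring.
apply: mulr_ge0; first by rewrite mulr_ge0 ?sqr_ge0 ?expR_ge0.
have /andP[l1 l2] := h _ ls; have /andP[m1 m2] := h _ ms; lra.
Qed.

Lemma expsum1_le t : expsum s 1 t <= top * expsum s 0 t.
Proof.
case: dom => _ _ _ h; rewrite /expsum mulr_sumr !big_seq; apply: ler_sum => l ls.
rewrite expr1 expr0 mul1r; apply: ler_wpM2r; first exact: expR_ge0.
by have /andP[] := h _ ls.
Qed.

End Fixed.

Definition direction_radius s h t :=
  Num.sqrt (expsum s 1 t ^+ 2 + h ^+ 2 * gram s t).

                                                                                
                                                                 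
(** The cosine of the polar angle of the plane vector with coordinates [expsum s 1 t] and [h] times
    the square root of [gram s t]. *)
Definition direction s h t := expsum s 1 t / direction_radius s h t.

Definition ddirection s h t :=
  h ^+ 2 * (2 * expsum s 2 t * gram s t - expsum s 1 t * dgram s t)
  / (2 * direction_radius s h t ^+ 3).

Section Direction.
Variables (s : seq R) (top bot h : R).
Hypothesis dom : dominant_in s top bot.
Hypothesis h1 : 1 <= h.

Let gram0 := dominant_gram_gt0 _ _ _ dom.

Let hgram t : 0 < h ^+ 2 * gram s t.
Proof. by rewrite mulr_gt0 // exprn_gt0 // (lt_le_trans _ h1). Qed.

Let rad2 t : 0 < expsum s 1 t ^+ 2 + h ^+ 2 * gram s t.
Proof. by rewrite ltr_wpDl ?sqr_ge0. Qed.

Lemma direction_radius_gt0 t : 0 < direction_radius s h t.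
Proof. by rewrite sqrtr_gt0. Qed.

Lemma sqr_direction_radius t :
  direction_radius s h t ^+ 2 = expsum s 1 t ^+ 2 + h ^+ 2 * gram s t.
Proof. by rewrite sqr_sqrtr // ltW. Qed.

Lemma is_derive_direction t : is_derive t 1 (direction s h) (ddirection s h t).
Proof.
have r0 := direction_radius_gt0 t.
have dR := is_derive_sqrt (is_derive_add
  (is_derive_sqr (is_derive_expsum s 1 t))
  (is_derive_mul (is_derive_cst1 (h ^+ 2) t) (is_derive_gram s t))) (rad2 t).
apply: (is_derive_val (is_derive_mul (is_derive_expsum s 1 t)
  (is_derive_inv dR (lt0r_neq0 r0)))).
have e := sqr_direction_radius t.
rewrite -!/(direction_radius s h t) /ddirection.
move: e r0; move: (direction_radius _ _ _) => r e r0.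
move: (lt0r_neq0 r0) => rn.
have -> : h ^+ 2 * (2 * expsum s 2 t * gram s t - expsum s 1 t * dgram s t) =
  2 * expsum s 2 t * r ^+ 2 - expsum s 1 t * (2 * expsum s 1 t * expsum s 2 t + h ^+ 2 * dgram s t).
  by rewrite e; ring.
by field.
Qed.

Lemma continuous_ddirection : continuous (ddirection s h).
Proof.
have c1 := @continuous_expsum R s 1; have c2 := @continuous_expsum R s 2.
have cg := @continuous_gram R s; have cd := @continuous_dgram R s.
apply: continuous_mul; first apply: continuous_mul; first exact: continuous_cst1.
  apply: continuous_add; first by apply: continuous_mul => //; apply: continuous_mul => //; exact: continuous_cst1.
  by apply: continuous_opp; exact: continuous_mul.
apply: continuous_inv.
  by move=> t; rewrite mulf_neq0 // expf_neq0 // lt0r_neq0 // direction_radius_gt0.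
apply: continuous_mul; first exact: continuous_cst1.
apply: continuous_pow; apply: continuous_sqrt; apply: continuous_add; first exact: continuous_pow.
by apply: continuous_mul => //; exact: continuous_cst1.
Qed.

Lemma direction_lt1 t : `|direction s h t| < 1.
Proof.
have r0 := direction_radius_gt0 t.
rewrite normrM normfV (gtr0_norm r0) ltr_pdivrMr // mul1r.
by rewrite -sqrtr_sqr ltr_sqrt // ltrDl.
Qed.

                                                                     
                                                                 
(** Write [A], [B], [C] for the sums of order 0, 1, 2 and [D] for [gram]. From
    [dgram <= 2 * top * D] and [B ^+ 2 <= A * C], the numerator is at most
    [2 * B * D * (top - B / A)]. With [v ^+ 2 = h ^+ 2 * D], the radius satisfies [r >= v] and
    [r ^+ 2 = B ^+ 2 + v ^+ 2 >= 2 * B * v], so [r ^+ 3 >= 2 * B * v ^+ 2] and [h] cancels. The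
    right side is half the derivative of [top * t - ln A]. *)
Lemma ddirection_ge_outward t : 0 <= expsum s 1 t ->
  - ddirection s h t <= 2^-1 * (top - expsum s 1 t / expsum s 0 t).
Proof.
move=> a1; have a0 := dominant_expsum0_gt0 _ _ _ dom t.
have D0 := gram0 t; have r0 := direction_radius_gt0 t.
have e := sqr_direction_radius t; have D1 := dgram_le _ _ _ dom t.
have l1 := expsum1_le _ _ _ dom t.
rewrite /ddirection; move: (direction_radius _ _ _) e r0 => r e r0.
have eD : expsum s 0 t * expsum s 2 t = gram s t + expsum s 1 t ^+ 2 by rewrite /gram; ring.
move: (expsum s 0 t) (expsum s 1 t) (expsum s 2 t) (gram s t) (dgram s t)
  a0 a1 D0 e D1 l1 eD => A B C D E A0 B0 D0 e D1 l1 eD.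
set q := top - B / A.
have q0 : 0 <= q by rewrite subr_ge0 ler_pdivrMr.
have h0 : 0 < h by exact: lt_le_trans h1.
have k1 : B * E - 2 * C * D <= 2 * B * D * q.
  have k : B * (B / A) <= C.
    by rewrite mulrA ler_pdivrMr // [C * A]mulrC eD; nra.
  have : B * E <= B * (2 * top * D) by apply: ler_wpM2l.
  have : 2 * D * (B * (B / A)) <= 2 * D * C by apply: ler_wpM2l => //; rewrite mulr_ge0 // ltW.
  rewrite /q; lra.
have k2 : 2 * B * (h ^+ 2 * D) <= r ^+ 3.
  set v := Num.sqrt (h ^+ 2 * D).
  have hD : 0 < h ^+ 2 * D by rewrite mulr_gt0 // exprn_gt0.
  have v2 : v ^+ 2 = h ^+ 2 * D by rewrite sqr_sqrtr // ltW.
  have v0 : 0 < v by rewrite sqrtr_gt0.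
  have vr : v <= r.
    by rewrite -(@ler_pXn2r _ 2) ?nnegrE ?(ltW v0) ?(ltW r0) // v2 e lerDr sqr_ge0.
  rewrite -v2; have -> : r ^+ 3 = r * (B ^+ 2 + v ^+ 2) by rewrite v2 -e; ring.
  have -> : 2 * B * v ^+ 2 = v * (2 * B * v) by ring.
  apply: ler_pM => //; [exact: ltW | by rewrite !mulr_ge0 // ltW |].
  by rewrite -subr_ge0; have := sqr_ge0 (B - v); lra.
rewrite -mulNr ler_pdivrMr; last by rewrite mulr_gt0 // exprn_gt0.
rewrite -mulrN.
have -> : - (2 * C * D - B * E) = B * E - 2 * C * D by ring.
apply: (@le_trans _ _ (h ^+ 2 * (2 * B * D * q))).
  by apply: ler_wpM2l => //; exact: sqr_ge0.
have -> : h ^+ 2 * (2 * B * D * q) = q * (2 * B * (h ^+ 2 * D)) by ring.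
have -> : 2^-1 * q * (2 * r ^+ 3) = q * r ^+ 3 by field.
exact: ler_wpM2l.
Qed.

End Direction.
End Dominance.

Section InwardBound.
Context {R : realType}.
Implicit Types (s : seq R) (t l h top bot : R).

                                                                             
                                         
(** The n-th derivative of a function [J]: the part of [gram] carried by the pairs with
    [j + k < 2 * l], divided by [l ^+ 2 * expR (l * t) ^+ 2]. All exponents are negative, so [J] is
    nonincreasing. *)
Definition lowpairs s l n t :=
  (\sum_(j <- s) \sum_(k <- s | j + k < 2 * l)
     (j - k) ^+ 2 * (j + k - 2 * l) ^+ n * expR ((j + k - 2 * l) * t))
  / (2 * l ^+ 2).

Lemma is_derive_lowpairs s l n t :
  is_derive t 1 (lowpairs s l n) (lowpairs s l n.+1 t).
Proof.
pose f (j k x : R) := (j - k) ^+ 2 * (j + k - 2 * l) ^+ n * expR ((j + k - 2 * l) * x).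
pose df (j k x : R) := (j - k) ^+ 2 * (j + k - 2 * l) ^+ n.+1 * expR ((j + k - 2 * l) * x).
have d1 j k : is_derive t 1 (f j k) (df j k t).
  apply: (is_derive_val (is_derive_mul (is_derive_cst1 _ _)
    (is_derive_exp (j + k - 2 * l) t))).
  by rewrite mul0r add0r /df [_ ^+ n.+1]exprSr; ring.
have d2 := is_derive_bigsum _ s xpredT
  (fun j x => \sum_(k <- s | j + k < 2 * l) f j k x)
  (fun j x => \sum_(k <- s | j + k < 2 * l) df j k x) t
  (fun j => is_derive_bigsum _ s (fun k => j + k < 2 * l) (f j) (df j) t (d1 j)).
apply: (is_derive_val (is_derive_mul d2 (is_derive_cst1 (2 * l ^+ 2)^-1 t))).
by rewrite mulr0 addr0.
Qed.

Lemma lowpairs0_ge0 s l t : 0 <= lowpairs s l 0 t.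
Proof.
apply: divr_ge0; last by rewrite mulr_ge0 ?sqr_ge0.
apply: sumr_ge0 => j _; apply: sumr_ge0 => k _.
by rewrite expr0 mulr1 mulr_ge0 ?sqr_ge0 ?expR_ge0.
Qed.

Lemma lowpairs1_le0 s l t : lowpairs s l 1 t <= 0.
Proof.
rewrite /lowpairs mulr_le0_ge0 //; last by rewrite invr_ge0 mulr_ge0 ?sqr_ge0.
apply: sumr_le0 => j _; apply: sumr_le0 => k jk.
rewrite mulr_le0_ge0 ?expR_ge0 // expr1 mulr_ge0_le0 ?sqr_ge0 //.
by rewrite subr_le0 ltW.
Qed.

(** A nondecreasing function with values in [0, 1]; it will charge the root [l] at most 1 in the
    variation of [direction]. *)
Definition lowfactor s l t := (Num.sqrt (1 + lowpairs s l 0 t))^-1.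

Definition dlowfactor s l t :=
  - lowpairs s l 1 t / (2 * Num.sqrt (1 + lowpairs s l 0 t) ^+ 3).

Let q0 s l t : 0 < 1 + lowpairs s l 0 t.
Proof. by rewrite ltr_pwDl // lowpairs0_ge0. Qed.

Lemma is_derive_lowfactor s l t : is_derive t 1 (lowfactor s l) (dlowfactor s l t).
Proof.
have r0 : Num.sqrt (1 + lowpairs s l 0 t) != 0 by rewrite lt0r_neq0 // sqrtr_gt0.
apply: (is_derive_val (is_derive_inv (is_derive_sqrt
  (is_derive_add (is_derive_cst1 1 t) (is_derive_lowpairs s l 0 t)) (q0 s l t)) r0)).
by rewrite /dlowfactor; move: (Num.sqrt _) r0 => r r0; field.
Qed.

Lemma continuous_dlowfactor s l : continuous (dlowfactor s l).
Proof.
have c0 := is_derive_continuous (is_derive_lowpairs s l 0).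
have c1 := is_derive_continuous (is_derive_lowpairs s l 1).
apply: continuous_mul; first exact: continuous_opp.
apply: continuous_inv.
  by move=> t; rewrite mulf_neq0 // expf_neq0 // lt0r_neq0 // sqrtr_gt0.
apply: continuous_mul; first exact: continuous_cst1.
apply: continuous_pow; apply: continuous_sqrt; apply: continuous_add => //.
exact: continuous_cst1.
Qed.

Lemma dlowfactor_ge0 s l t : 0 <= dlowfactor s l t.
Proof.
rewrite divr_ge0 // ?oppr_ge0 ?lowpairs1_le0 // mulr_ge0 // exprn_ge0.
Qed.

Lemma lowfactor_increment s l u v : lowfactor s l v - lowfactor s l u <= 1.
Proof.
have h t : 0 <= lowfactor s l t <= 1.
  rewrite invr_ge0 sqrtr_ge0 /= invf_le1 ?sqrtr_gt0 //.
  have := @ler_wsqrtr R 1 (1 + lowpairs s l 0 t); rewrite sqrtr1; apply.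
  by rewrite lerDl lowpairs0_ge0.
by have /andP[h1 h2] := h u; have /andP[h3 h4] := h v; lra.
Qed.

Section Inward.
Variables (s : seq R) (top bot h : R).
Hypothesis dom : dominant_in s top bot.
Hypothesis h1 : 1 <= h.

Let gram0 := dominant_gram_gt0 _ _ _ dom.

Let pair_sum_low l n t : l != 0 ->
  l ^+ 2 * expR (l * t) ^+ 2 * lowpairs s l n t =
  2^-1 * \sum_(j <- s) \sum_(k <- s | j + k < 2 * l)
    (j - k) ^+ 2 * (j + k - 2 * l) ^+ n * expR ((j + k) * t).
Proof.
move=> l0; rewrite /lowpairs; set S := (X in X / _).
have -> : l ^+ 2 * expR (l * t) ^+ 2 * (S / (2 * l ^+ 2)) =
  2^-1 * (expR (l * t) ^+ 2 * S) by field.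
congr (_ * _); rewrite /S mulr_sumr; apply: eq_bigr => j _.
rewrite mulr_sumr; apply: eq_bigr => k _.
have -> : expR ((j + k) * t) = expR (l * t) ^+ 2 * expR ((j + k - 2 * l) * t).
  by rewrite -expRM_natl -expRD; congr expR; rewrite -[2%:R]/2; ring.
ring.
Qed.

(** The low pairs give the [lowpairs] part exactly. The summand 1 comes from the pair of [top] and
    [l], for which [(top - l) ^+ 2 >= l ^+ 2] and [expR ((top + l) * t) >= expR (2 * l * t)],
    because [l < 0 < top] and [t >= 0]. *)
Lemma gram_ge_lowpairs l t : l \in s -> l < 0 -> 0 <= t ->
  l ^+ 2 * expR (l * t) ^+ 2 * (1 + lowpairs s l 0 t) <= gram s t.
Proof.
move=> ls l0 t0; case: dom => ts _ /andP[_ top0] _.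
have ltop : top != l by rewrite gt_eqF // (lt_trans l0).
rewrite mulrDr pair_sum_low ?lt_eqF // mulr1.
rewrite -(@ler_pM2l _ 2) // gramE.
pose g j k := (j - k) ^+ 2 * expR ((j + k) * t).
have g0 j k : 0 <= g j k by rewrite mulr_ge0 ?sqr_ge0 ?expR_ge0.
rewrite [leRHS](eq_bigr (fun j => \sum_(k <- s | j + k < 2 * l) g j k
   + \sum_(k <- s | ~~ (j + k < 2 * l)) g j k)); last first.
  by move=> j _; rewrite [LHS](bigID (fun k => j + k < 2 * l)).
rewrite big_split /= mulrDr [2 * (2^-1 * _)]mulrA divff // mul1r addrC lerD //; last first.
  by apply: ler_sum => j _; apply: ler_sum => k _; rewrite expr0 mulr1.
have G0 j : 0 <= \sum_(k <- s | ~~ (j + k < 2 * l)) g j k by apply: sumr_ge0.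
apply: (le_trans _ (sumr_mem2_ge s _ top l G0 ts ls ltop)).
have gE j k : k \in s -> ~~ (j + k < 2 * l) ->
    g j k <= \sum_(k <- s | ~~ (j + k < 2 * l)) g j k.
  move=> ks jk; rewrite big_mkcond /=.
  have := @sumr_mem_ge R s (fun k => if ~~ (j + k < 2 * l) then g j k else 0) k.
  by rewrite jk; apply => // y; case: ifP.
(* Neither order of the pair of [top] and [l] is a low pair, so both terms are still available after
   the low pairs have been split off. *)
have lt1 : ~~ (top + l < 2 * l) by rewrite -leNgt; lra.
have lt2 : ~~ (l + top < 2 * l) by rewrite -leNgt; lra.
apply: (le_trans _ (lerD (gE top l ls lt1) (gE l top ts lt2))).
have gg : l ^+ 2 * expR (l * t) ^+ 2 <= g top l.
  apply: ler_pM; rewrite ?sqr_ge0 //.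
    by rewrite -subr_ge0 (_ : _ - _ = top * (top - 2 * l)); [rewrite mulr_ge0; lra | ring].
  rewrite -expRM_natl ler_expR -[2%:R]/2.
  by rewrite -subr_ge0 (_ : _ - _ = t * (top - l)); [rewrite mulr_ge0; lra | ring].
have ggE : g l top = g top l by rewrite /g -[(l - top) ^+ 2]sqrrN opprB [l + top]addrC.
rewrite ggE; lra.
Qed.

(** The left side is a sum over pairs with factor [2 * l - j - k]; only the low pairs contribute
    positively, and they add up to the right side. *)
Lemma dgram_ge_lowpairs l t : l < 0 ->
  2 * l * gram s t - dgram s t <=
  - (l ^+ 2 * expR (l * t) ^+ 2 * lowpairs s l 1 t).
Proof.
move=> l0; rewrite pair_sum_low ?lt_eqF // -(@ler_pM2l _ 2) // mulrBr mulrCA.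
rewrite gramE dgramE mulrN [2 * (2^-1 * _)]mulrA divff // mul1r mulr_sumr -sumrB -sumrN.
apply: ler_sum => j _; rewrite mulr_sumr -sumrB -sumrN [leRHS]big_mkcond /=.
apply: ler_sum => k _; case: ifPn => [_|].
  by rewrite le_eqVlt; apply/orP; left; apply/eqP; ring.
rewrite -leNgt => jk.
rewrite (_ : _ - _ = - ((j - k) ^+ 2 * expR ((j + k) * t) * (j + k - 2 * l))); last by ring.
rewrite oppr_le0 mulr_ge0 ?subr_ge0 //.
by rewrite mulr_ge0 ?sqr_ge0 ?expR_ge0.
Qed.

(** With [X = - l * expR (l * t)] and [J] for [lowpairs], the two preceding bounds read
    [gram >= X ^+ 2 * (1 + J)] and [2 * l * gram - dgram <= - X ^+ 2 * J']. The powers of [X] cancel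
    and the derivative of [(1 + J)] to the power -1/2 remains. *)
Lemma dlowfactor_ge l t : l \in s -> l < 0 -> 0 <= t ->
  - l * expR (l * t) * (2 * l * gram s t - dgram s t)
  / (2 * Num.sqrt (gram s t) ^+ 3) <= dlowfactor s l t.
Proof.
move=> ls l0 t0; have D0 := gram0 t.
have k1 := gram_ge_lowpairs l t ls l0 t0; have k2 := dgram_ge_lowpairs l t l0.
rewrite /dlowfactor; have := q0 s l t; have := lowpairs1_le0 s l t.
move: (lowpairs s l 1 t) k2 => J k2 J0; move: (1 + lowpairs s l 0 t) k1 => q k1 q1.
set X := - l * expR (l * t).
have X0 : 0 < X by rewrite mulr_gt0 ?expR_gt0 // oppr_gt0.
have XE : l ^+ 2 * expR (l * t) ^+ 2 = X ^+ 2 by rewrite /X exprMn sqrrN.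
rewrite XE in k1 k2.
have d0 : 0 < Num.sqrt (gram s t) by rewrite sqrtr_gt0.
have r0 : 0 < Num.sqrt q by rewrite sqrtr_gt0.
have kd : X * Num.sqrt q <= Num.sqrt (gram s t).
  have -> : X * Num.sqrt q = Num.sqrt (X ^+ 2 * q).
    by rewrite sqrtrM ?sqr_ge0 // sqrtr_sqr ger0_norm // ltW.
  exact: ler_wsqrtr.
have kd3 : X ^+ 3 * Num.sqrt q ^+ 3 <= Num.sqrt (gram s t) ^+ 3.
  by rewrite -exprMn ler_pXn2r // nnegrE ltW // mulr_gt0.
move: (Num.sqrt (gram s t)) (Num.sqrt q) d0 r0 kd3 => d r d0 r0 kd3.
rewrite ler_pdivrMr; last by rewrite mulr_gt0 // exprn_gt0.
apply: (@le_trans _ _ (X * - (X ^+ 2 * J))).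
  by apply: ler_wpM2l => //; exact: ltW.
rewrite [leRHS]mulrAC ler_pdivlMr; last by rewrite mulr_gt0 // exprn_gt0.
have := ler_wpM2l (_ : 0 <= - (2 * J)) kd3; rewrite oppr_ge0 => /(_ _).
by move=> k; have := k (ltac:(lra)); lra.
Qed.

                                                                            
                                                                       
                                                
(** The numerator [N] of [- ddirection] splits root by root into terms [F l]. If [N > 0] then
    [dgram < 0], so [F l <= 0] for [l >= 0]; also [F bot <= 0] by [dgram_ge]. The other terms are
    bounded by [dlowfactor_ge]. The parameter disappears because [h * d <= r] and [1 <= h] give
    [h ^+ 2 * d ^+ 3 <= r ^+ 3], where [d ^+ 2] is [gram]. *)
Lemma ddirection_ge_inward t : 0 <= t -> expsum s 1 t < 0 ->
  - ddirection s h t <= \sum_(l <- s | bot < l < 0) dlowfactor s l t.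
Proof.
move=> t0 a1; have D0 := gram0 t; case: (dom) => _ bs /andP[b0 _] bd.
have S0 : 0 <= \sum_(l <- s | bot < l < 0) dlowfactor s l t.
  by apply: sumr_ge0 => l _; exact: dlowfactor_ge0.
have a2 := dominant_expsum2_gt0 _ _ _ dom t.
have r0 := direction_radius_gt0 _ _ _ _ dom h1 t.
have r2 := sqr_direction_radius _ _ _ _ dom h1 t.
have h0 : 0 < h by exact: lt_le_trans h1.
rewrite /ddirection; set r := direction_radius s h t in r0 r2 *.
set N := expsum s 1 t * dgram s t - 2 * expsum s 2 t * gram s t.
rewrite -mulNr -mulrN (_ : - (_ - _) = N); last by rewrite /N; ring.
have [N0|N0] := leP N 0.
  apply: le_trans S0; rewrite mulr_le0_ge0 //; last by rewrite invr_ge0 mulr_ge0 // exprn_ge0 // ltW.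
  by rewrite mulr_ge0_le0 ?sqr_ge0.
set d := Num.sqrt (gram s t); have d0 : 0 < d by rewrite sqrtr_gt0.
have d2 : d ^+ 2 = gram s t by rewrite sqr_sqrtr // ltW.
have rd : h * d <= r.
  rewrite -(@ler_pXn2r _ 2) ?nnegrE ?(ltW r0) ?(mulr_ge0 (ltW h0) (ltW d0)) //.
  by rewrite r2 exprMn d2 lerDr sqr_ge0.
apply: (@le_trans _ _ (N / (2 * d ^+ 3))).
  rewrite ler_pdivlMr; last by rewrite mulr_gt0 // exprn_gt0.
  rewrite mulrAC ler_pdivrMr; last by rewrite mulr_gt0 // exprn_gt0.
  have : h ^+ 2 * d ^+ 3 <= r ^+ 3.
    apply: (@le_trans _ _ (h ^+ 3 * d ^+ 3)).
      apply: ler_wpM2r; first by rewrite exprn_ge0 // ltW.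
      by rewrite exprS ler_peMl // sqr_ge0.
    by rewrite -exprMn ler_pXn2r // nnegrE ltW // mulr_gt0.
  by move=> k; have := ler_wpM2l (ltW N0) k; lra.
have dg0 : dgram s t < 0.
  rewrite ltNge; apply/negP => dg; move: N0; rewrite ltNge => /negP; apply.
  rewrite /N subr_le0; apply: (@le_trans _ _ 0).
    by rewrite mulr_le0_ge0 // ltW.
  by rewrite !mulr_ge0 // ltW.
pose F l := - l * expR (l * t) * (2 * l * gram s t - dgram s t).
have NF : N <= \sum_(l <- s | bot < l < 0) F l.
  have -> : N = \sum_(l <- s) F l.
    have -> : N = expsum s 1 t * dgram s t + expsum s 2 t * (- 2 * gram s t).
      by rewrite /N; ring.
    rewrite /expsum !mulr_suml -big_split /=; apply: eq_bigr => l _.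
    by rewrite /F; ring.
  rewrite [leRHS]big_mkcond /= !big_seq; apply: ler_sum => l ls.
  case: ifPn => // nl; have /andP[l1 l2] := bd _ ls.
  have [l0|l0] := leP 0 l.
    rewrite /F mulr_le0_ge0 //.
      by rewrite mulNr oppr_le0 mulr_ge0 ?expR_ge0.
    by rewrite subr_ge0 (le_trans (ltW dg0)) // mulr_ge0 ?mulr_ge0 // ltW.
  have -> : l = bot.
    by apply/eqP; rewrite eq_le l1 andbT leNgt; move: nl; rewrite l0 andbT.
  rewrite /F mulr_ge0_le0 //; first by rewrite mulr_ge0 ?expR_ge0 // oppr_ge0 ltW.
  by rewrite subr_le0; exact: dgram_ge _ _ _ dom t.
apply: (@le_trans _ _ ((\sum_(l <- s | bot < l < 0) F l) / (2 * d ^+ 3))).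
  by apply: ler_wpM2r => //; rewrite invr_ge0 mulr_ge0 // exprn_ge0 // ltW.
rewrite mulr_suml big_seq_cond [leRHS]big_seq_cond; apply: ler_sum => l /and3P[ls _ l0].
exact: dlowfactor_ge.
Qed.

End Inward.
End InwardBound.

Section DirectionVariation.
Context {R : realType}.
Implicit Types (s : seq R) (t l h top bot : R).
Local Notation mu := (@lebesgue_measure R).

Lemma is_derive_reflect (f : R -> R) (t df : R) :
  is_derive (- t) 1 f df -> is_derive t 1 (fun x => f (- x)) (- df).
Proof.
move=> hf; apply: (is_derive_val (@is_derive1_comp _ f -%R t df (-1) hf (is_deriveNid _ _))).
by rewrite mulrN1.
Qed.

Lemma continuous_reflect (f : R -> R) : continuous f -> continuous (fun x => f (- x)).
Proof. by move=> cf t; exact: (cvg_comp (fun x => - x) f (cvgN (@cvg_id _ (nbhs t))) (cf (- t))). Qed.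

Lemma count_strictly_between s top bot : dominant_in s top bot ->
  (count (fun l => (bot < l < 0)%R) s + 2 <= size s)%N.
Proof.
move=> [ts bs /andP[b0 t0] _].
rewrite -(count_predC (fun l => bot < l < 0) s) leq_add2l.
have -> : 2%N = size [:: top; bot] by [].
rewrite -size_filter; apply: uniq_leq_size.
  by rewrite /= inE gt_eqF // (lt_trans b0).
move=> l; rewrite !inE => /orP[/eqP->|/eqP->]; rewrite mem_filter /=.
  by rewrite ts andbT [top < 0]ltNge (ltW t0) andbF.
by rewrite bs ltxx.
Qed.

Section Half.
Variables (s : seq R) (top bot h : R).
Hypothesis dom : dominant_in s top bot.
Hypothesis h1 : 1 <= h.

Let a0_gt0 := dominant_expsum0_gt0 _ _ _ dom.
Let c : R := (expsum s 1 0 < 0)%R%:R.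

(** Its derivative dominates the absolute value of [ddirection] for [t > 0]. The switch [c] keeps
    the inward term only when [expsum s 1] is negative at 0: being nondecreasing, that sum is
    otherwise nonnegative on the whole half-line. *)
Definition half_majorant t := direction s h t + (top * t - ln (expsum s 0 t))
  + 2 * (c * \sum_(l <- s | bot < l < 0) lowfactor s l t).

Definition dhalf_majorant t := ddirection s h t
  + (top - expsum s 1 t / expsum s 0 t)
  + 2 * (c * \sum_(l <- s | bot < l < 0) dlowfactor s l t).

Lemma is_derive_half_majorant t : is_derive t 1 half_majorant (dhalf_majorant t).
Proof.
have dl := is_derive_bigsum _ s (fun l => bot < l < 0) (lowfactor s) (dlowfactor s) t
  (fun l => is_derive_lowfactor s l t).
apply: (is_derive_val (is_derive_add (is_derive_add
  (is_derive_direction s top bot h dom h1 t)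
  (is_derive_add (is_derive_mul (is_derive_cst1 top t) (is_derive_id t 1))
    (is_derive_opp (is_derive_ln (is_derive_expsum s 0 t) (a0_gt0 t)))))
  (is_derive_mul (is_derive_cst1 2 t) (is_derive_mul (is_derive_cst1 c t) dl)))).
by rewrite /dhalf_majorant !mul0r !add0r mulr1.
Qed.

Lemma continuous_dhalf_majorant : continuous dhalf_majorant.
Proof.
apply: continuous_add; first apply: continuous_add.
- exact: continuous_ddirection dom h1.
- apply: continuous_add; first exact: continuous_cst1.
  apply: continuous_opp; apply: continuous_mul; first exact: continuous_expsum.
  by apply: continuous_inv; [move=> t; rewrite gt_eqF | exact: continuous_expsum].
- apply: continuous_mul; first exact: continuous_cst1.
  apply: continuous_mul; first exact: continuous_cst1.
  under eq_fun do rewrite -big_filter.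
  by apply: continuous_bigsum => l; exact: continuous_dlowfactor.
Qed.

Lemma ddirection_le_majorant t : 0 < t -> `|ddirection s h t| <= dhalf_majorant t.
Proof.
move=> t0; rewrite /dhalf_majorant.
set b := top - _; set S := \sum_(l <- s | _) _.
have b0 : 0 <= b.
  by rewrite subr_ge0 ler_pdivrMr // (expsum1_le _ _ _ dom).
have S0 : 0 <= S by apply: sumr_ge0 => l _; exact: dlowfactor_ge0.
have c0 : 0 <= c by rewrite /c ler0n.
have cS0 := mulr_ge0 c0 S0.
(* The absolute value of [d] is [d] plus twice the negative part of [d], so it suffices to bound
   [- d]. *)
suff hb : - ddirection s h t <= 2^-1 * b + c * S.
  by have [?|?] := ger0P (ddirection s h t); lra.
have [a1|a1] := leP 0 (expsum s 1 t).
  by have := ddirection_ge_outward _ _ _ _ dom h1 t a1; rewrite -/b; lra.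
have -> : c = 1.
  by rewrite /c (le_lt_trans _ a1) // expsum1_nondecreasing // ltW.
by have := ddirection_ge_inward _ _ _ _ dom h1 t (ltW t0) a1; rewrite -/S; lra.
Qed.

(** [direction] stays below 1; the logarithmic term gains at most [ln n], because [expsum s 0] is
    [n] at 0 and at least [expR (top * T)] at [T]; each of the at most [n - 2] factors gains at most
    1. *)
Lemma half_majorant_increment T : 0 <= T ->
  half_majorant T - half_majorant 0 <=
  1 - direction s h 0 + ln (size s)%:R + 2 * (c * (size s - 2)%N%:R).
Proof.
move=> T0; have := direction_lt1 _ _ _ _ dom h1 T.
rewrite ltr_norml => /andP[_ d1].
have e0 : expsum s 0 0 = (size s)%:R.
  rewrite /expsum; under eq_bigr do rewrite expr0 mulr0 expR0 mulr1.
  by rewrite big_const_seq count_predT iter_addr addr0.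
have eT : top * T <= ln (expsum s 0 T).
  rewrite -[leLHS]expRK ler_ln ?posrE ?expR_gt0 //.
  have [ts _ _ _] := dom; apply: (le_trans _ (sumr_mem_ge s (fun l => l ^+ 0 * expR (l * T)) top _ ts)).
    by rewrite expr0 mul1r.
  by move=> y; rewrite expr0 mul1r expR_ge0.
have c0 : 0 <= c by rewrite /c ler0n.
have lf : \sum_(l <- s | bot < l < 0) lowfactor s l T -
    \sum_(l <- s | bot < l < 0) lowfactor s l 0 <= (size s - 2)%N%:R.
  rewrite -sumrB; apply: (@le_trans _ _ (\sum_(l <- s | bot < l < 0) 1)).
    by apply: ler_sum => l _; exact: lowfactor_increment.
  rewrite big_const_seq iter_addr addr0 ler_nat.
  have n2 := count_strictly_between _ _ _ dom.
  by rewrite leq_subRL ?(leq_trans _ n2) ?leq_addl // addnC.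
have := ler_wpM2l c0 lf; rewrite /half_majorant mulr0 e0 mulrBr; lra.
Qed.

End Half.

Lemma ddirection_opp s h t : ddirection (map -%R s) h t = ddirection s h (- t).
Proof.
rewrite /ddirection /direction_radius !gram_opp !dgram_opp !expsum_opp.
have -> : (-1) ^+ 2 = 1 :> R by ring.
by rewrite !expr1 !mulN1r mul1r sqrrN mulrNN.
Qed.

Lemma direction_opp s h t : direction (map -%R s) h t = - direction s h (- t).
Proof.
rewrite /direction /direction_radius !gram_opp !expsum_opp.
by rewrite !expr1 !mulN1r sqrrN mulNr.
Qed.

(** Adds the two half-line bounds, the left one applied to the negated roots. The values of
    [direction] at 0 cancel. *)
Lemma direction_variation s top bot h : dominant_in s top bot -> 1 <= h ->
  (\int[mu]_t `|ddirection s h t|%:E <=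
   (2 * ((size s)%:R - 1 + ln (size s)%:R))%:E)%E.
Proof.
move=> dom h1; have dom' := dominant_in_opp _ _ _ dom.
have cd := continuous_ddirection _ _ _ _ dom h1.
have mf : measurable_fun setT (fun t => `|ddirection s h t|).
  by apply: continuous_measurable_fun; exact: continuous_norm.
apply: integral_setT_le => // T T0.
rewrite (integral_itv_split _ _ 0) ?oppr_le0 //.
pose G := half_majorant s top bot h; pose g := dhalf_majorant s top bot h.
pose G' := half_majorant (map -%R s) (- bot) (- top) h.
pose g' := dhalf_majorant (map -%R s) (- bot) (- top) h.
have right_half : (\int[mu]_(x in `[0%R, T]) `|ddirection s h x|%:E <= (G T - G 0)%:E)%E.
  apply: (integral_le_increment _ g) => //.
  - exact: is_derive_half_majorant dom h1.
  - exact: continuous_dhalf_majorant dom h1.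
  - by move=> x /andP[x0 _]; exact: ddirection_le_majorant dom h1 x x0.
have left_half : (\int[mu]_(x in `[(- T)%R, 0%R]) `|ddirection s h x|%:E <=
    (- G' (- 0) - - G' (- (- T)))%:E)%E.
  apply: (integral_le_increment _ (fun x => g' (- x)) (fun x => - G' (- x))) => //.
  - by rewrite oppr_le0.
  - move=> x; apply: (is_derive_val (is_derive_opp (is_derive_reflect _ _ _
      (is_derive_half_majorant _ _ _ _ dom' h1 (- x))))).
    by rewrite opprK.
  - exact: continuous_reflect (continuous_dhalf_majorant _ _ _ _ dom' h1).
  - move=> x /andP[_ x0]; rewrite -[x in ddirection s h x]opprK -ddirection_opp.
    by apply: (ddirection_le_majorant _ _ _ _ dom' h1); rewrite oppr_gt0.
apply: (le_trans (leeD left_half right_half)).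
rewrite -EFinD lee_fin oppr0 !opprK.
have := half_majorant_increment _ _ _ _ dom h1 _ T0.
have := half_majorant_increment _ _ _ _ dom' h1 _ T0.
rewrite -/G -/G' direction_opp oppr0 opprK size_map expsum_opp oppr0 expr1 mulN1r.
rewrite oppr_lt0.
have n2 : (2 <= size s)%N.
  by apply: leq_trans (count_strictly_between _ _ _ dom); rewrite leq_addl.
have -> : (size s - 2)%N%:R = (size s)%:R - 2 :> R by rewrite natrB.
have n2' : 2 <= (size s)%:R :> R by rewrite ler_nat.
(* [expsum s 1 0] and its opposite are not both negative, so the inward term [2 * (n - 2)] is paid
   on at most one half-line. *)
by case: ltgtP => _ /=; rewrite ?mul0r ?mul1r => k1 k2; lra.
Qed.

End DirectionVariation.

                                        

(** * Spherical length and the integral of the turning rate *)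

Section SphericalLength.
Context {R : realType}.
Implicit Types (s : seq R) (t l : R).

                                                                               
                                                                                
                                                        
(** The ratio is twice the speed on the unit sphere of the normalized curve with coordinates
    [expR (l / 2 * t)]. Adding a largest root [l] to the list adds the latitude [atan (E / sqrt A)],
    where [E] is the new coordinate and [A] the squared norm of the old curve. As [l] is largest,
    this latitude is nondecreasing, and it ranges in [0, pi / 2]. The spherical speed is at most the
    latitude speed plus the old speed, so each root after the first costs [pi / 2]. *)
Lemma spherical_length_majorant s : s != [::] -> sorted >=%R s ->
  exists Y y : R -> R, [/\ forall t, is_derive t 1 Y (y t), continuous y,
    forall t, 0 <= y t,
    forall t, Num.sqrt (gram s t) / expsum s 0 t <= 2 * y t &
    forall u v, Y v - Y u <= ((size s)%:R - 1) * (pi / 2)].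
Proof.
elim: s => // l [|m s'] IH _ hs.
  exists (fun=> 0), (fun=> 0); split.
  - by move=> t; exact: is_derive_cst1.
  - exact: continuous_cst1.
  - by [].
  - move=> t; have -> : gram [:: l] t = 0.
      by rewrite /gram /expsum !big_seq1; ring.
    by rewrite sqrtr0 mul0r mulr0.
  - by move=> u v; rewrite !subrr mul0r.
set s := m :: s' in IH hs *.
have [|Y [y [dY cy y0 yE Yb]]] := IH isT; first exact: path_sorted hs.
have lmax k : k \in s -> k <= l.
  have tr : transitive (>=%R : rel R) by move=> a b c ba cb; exact: le_trans cb ba.
  have : path >=%R l s by exact: hs.
  by rewrite (path_sortedE tr) => /andP[/allP h _] /h.
pose A t := expsum s 0 t.
have A0 t : 0 < A t.
  by apply: (expsum_even_gt0 _ _ _ m); rewrite ?mem_head //; right.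
have A1 t : expsum s 1 t <= l * A t.
  rewrite /A /expsum mulr_sumr !big_seq; apply: ler_sum => k ks.
  by rewrite expr1 expr0 mul1r; apply: ler_wpM2r; [exact: expR_ge0 | exact: lmax].
pose E t := expR (l / 2 * t).
have E2 t : E t ^+ 2 = expR (l * t).
  by rewrite -expRM_natl; congr expR; rewrite -[2%:R]/2; field.
have consE k t : expsum (l :: s) k t = l ^+ k * E t ^+ 2 + expsum s k t.
  by rewrite /expsum big_cons E2.
pose u t := E t * (Num.sqrt (A t))^-1.
pose du t := E t * (l * A t - expsum s 1 t) / (2 * Num.sqrt (A t) * (A t + E t ^+ 2)).
have S2 t : Num.sqrt (A t) ^+ 2 = A t by rewrite sqr_sqrtr // ltW.
have S0 t : 0 < Num.sqrt (A t) by rewrite sqrtr_gt0.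
have E0 t : 0 < E t by exact: expR_gt0.
have AE0 t : 0 < A t + E t ^+ 2 by rewrite addr_gt0 // exprn_gt0.
have du0 t : 0 <= du t.
  apply: divr_ge0; first by rewrite mulr_ge0 ?subr_ge0 // ltW.
  by rewrite mulr_ge0 ?(ltW (AE0 t)) // mulr_ge0 // ltW.
exists (fun t => Y t + atan (u t)), (fun t => y t + du t); split.
- move=> t; apply: is_derive_add => //.
  have dS := is_derive_sqrt (is_derive_expsum s 0 t) (A0 t).
  apply: (is_derive_val (is_derive_atan (is_derive_mul (is_derive_exp (l / 2) t)
    (is_derive_inv dS (lt0r_neq0 (S0 t)))))).
  rewrite -/(A t) -/(E t) /u /du.
  have := S2 t; have := S0 t; move: (Num.sqrt (A t)) => S S0' e.
  have n1 : S != 0 by rewrite gt_eqF.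
  have n2 : S ^+ 2 + E t ^+ 2 != 0 by rewrite e gt_eqF.
  have n3 : S ^+ 2 * 1 + E t ^+ 2 * 1 != 0 by rewrite !mulr1.
  by rewrite -e; field; rewrite ?n1 ?n2.
- apply: continuous_add => //; have cA := @continuous_expsum R s 0.
  have cE := is_derive_continuous (is_derive_exp (l / 2)).
  apply: continuous_mul.
    apply: continuous_mul => //; apply: continuous_add.
      by apply: continuous_mul => //; exact: continuous_cst1.
    by apply: continuous_opp; exact: continuous_expsum.
  apply: continuous_inv.
    by move=> t; rewrite gt_eqF // mulr_gt0 // mulr_gt0.
  apply: continuous_mul.
    by apply: continuous_mul; [exact: continuous_cst1 | exact: continuous_sqrt].
  by apply: continuous_add => //; exact: continuous_pow.
- by move=> t; rewrite addr_ge0.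
- move=> t; have := yE t; rewrite -/(A t); set X := _ / A t => XE.
  have X0 : 0 <= X by rewrite divr_ge0 ?sqrtr_ge0 // ltW.
  have new0 : expsum (l :: s) 0 t = A t + E t ^+ 2 by rewrite consE expr0 mul1r addrC.
  rewrite new0 ler_pdivrMr //.
  apply: (@le_trans _ _ ((X + 2 * du t) * (A t + E t ^+ 2))); last first.
    apply: ler_wpM2r; [exact: ltW | lra].
  have Z0 : 0 <= (X + 2 * du t) * (A t + E t ^+ 2).
    by rewrite mulr_ge0 ?(ltW (AE0 t)) // addr_ge0 // mulr_ge0.
  rewrite -(ger0_norm Z0) -sqrtr_sqr; apply: ler_wsqrtr.
  rewrite exprMn; apply: (@le_trans _ _ ((X ^+ 2 + (2 * du t) ^+ 2) * (A t + E t ^+ 2) ^+ 2)).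
    have X2 : X ^+ 2 = gram s t / A t ^+ 2 by rewrite expr_div_n sqr_sqrtr // gram_ge0.
    (* The round metric in latitude coordinates: the squared speed is the squared latitude speed
       plus the squared old speed times the squared cosine of the latitude; that cosine is then
       bounded by 1. *)
    have -> : gram (l :: s) t = gram s t * (A t + E t ^+ 2) / A t
        + E t ^+ 2 * (l * A t - expsum s 1 t) ^+ 2 / A t.
      rewrite {1}/gram !consE /gram -/(A t); field.
      by rewrite gt_eqF.
    rewrite [leRHS]mulrDl; apply: lerD.
      rewrite X2 -mulrA [leRHS](_ : _ = gram s t * ((A t + E t ^+ 2) / A t * ((A t + E t ^+ 2) / A t))); last by field; rewrite gt_eqF.
      apply: ler_wpM2l; first exact: gram_ge0.
      by rewrite ler_peMr ?divr_ge0 ?(ltW (A0 t)) ?(ltW (AE0 t)) // ler_pdivlMr // mul1r lerDl sqr_ge0.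
    rewrite le_eqVlt; apply/orP; left; apply/eqP.
    transitivity (E t ^+ 2 * (l * A t - expsum s 1 t) ^+ 2 / Num.sqrt (A t) ^+ 2).
      by rewrite S2.
    have n1 := lt0r_neq0 (S0 t); have n2 := lt0r_neq0 (AE0 t).
    by rewrite /du; move: (Num.sqrt (A t)) n1 => S n1; field; rewrite n1 n2.
  apply: ler_wpM2r; first exact: sqr_ge0.
  have := mulr_ge0 X0 (du0 t); rewrite -subr_ge0 => h; rewrite sqrrD; lra.
- move=> a b; have := Yb a b; have := atan_ltpi2 (u b).
  have := @le_atan R 0 (u a); rewrite atan0 => /(_ _) h1 h2 h3.
  have {}h1 := h1 (mulr_ge0 (ltW (E0 a)) (ltW (_ : 0 < (Num.sqrt (A a))^-1))).
  have {}h1 : 0 <= atan (u a) by apply: h1; rewrite invr_gt0.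
  rewrite [size (l :: s)]/= -natr1; move: (size s)%:R h3 => n h3; lra.
Qed.

End SphericalLength.

Section Turning.
Context {R : realType}.
Implicit Types (s : seq R) (t l top bot : R).
Local Notation mu := (@lebesgue_measure R).

                                                                  
(** For doubled roots, [pi / 2] minus the angle between the curve and its velocity. *)
Definition position_angle s t := atan (expsum s 1 t / Num.sqrt (gram s t)).

Definition turning s t := expsum s 1 t * dgram s t
  / (2 * expsum s 0 t * expsum s 2 t * Num.sqrt (gram s t)).

Section Fixed.
Variables (s : seq R) (top bot : R).
Hypothesis dom : dominant_in s top bot.
Hypothesis hs : sorted >=%R s.

Let a0 := dominant_expsum0_gt0 _ _ _ dom.
Let a2 := dominant_expsum2_gt0 _ _ _ dom.
Let D0 := dominant_gram_gt0 _ _ _ dom.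
Let d0 t : 0 < Num.sqrt (gram s t). Proof. by rewrite sqrtr_gt0. Qed.

Lemma is_derive_position_angle t : is_derive t 1 (position_angle s)
  (Num.sqrt (gram s t) / expsum s 0 t - turning s t).
Proof.
apply: (is_derive_val (is_derive_atan (is_derive_mul (is_derive_expsum s 1 t)
  (is_derive_inv (is_derive_sqrt (is_derive_gram s t) (D0 t)) (lt0r_neq0 (d0 t)))))).
rewrite /turning; have d2 : Num.sqrt (gram s t) ^+ 2 = gram s t by rewrite sqr_sqrtr // ltW.
have e : expsum s 1 t ^+ 2 = expsum s 0 t * expsum s 2 t - Num.sqrt (gram s t) ^+ 2.
  by rewrite d2 /gram; ring.
have n0 := lt0r_neq0 (a0 t); have n2 := lt0r_neq0 (a2 t).
move: (Num.sqrt (gram s t)) (d0 t) e => d /lt0r_neq0 nd e.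
have -> : 1 + (expsum s 1 t / d) ^+ 2 = expsum s 0 t * expsum s 2 t / d ^+ 2.
  by rewrite expr_div_n e; field.
by field; rewrite n0 n2 nd.
Qed.

Lemma continuous_turning : continuous (turning s).
Proof.
have c0 := @continuous_expsum R s; have cg := @continuous_gram R s.
apply: continuous_mul; first by apply: continuous_mul => //; exact: continuous_dgram.
apply: continuous_inv => [t|]; first by rewrite gt_eqF // !mulr_gt0.
apply: continuous_mul; last exact: continuous_sqrt.
by apply: continuous_mul => //; apply: continuous_mul => //; exact: continuous_cst1.
Qed.

Lemma turning_sign t : (0 <= expsum s 1 t * dgram s t -> 0 <= turning s t) /\
  (expsum s 1 t * dgram s t <= 0 -> turning s t <= 0).
Proof.
have i0 : 0 <= (2 * expsum s 0 t * expsum s 2 t * Num.sqrt (gram s t))^-1.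
  by rewrite invr_ge0 ltW // !mulr_gt0.
by split => h; [exact: mulr_ge0 | exact: mulr_le0_ge0].
Qed.

Lemma position_angle_bound t : - (pi / 2) < position_angle s t < pi / 2.
Proof. by rewrite atan_gtNpi2 atan_ltpi2. Qed.

(** On the outer pieces [|turning|] is the ratio bounded by [2 * y] minus the derivative of the
    angle; on the middle one it is at most [2 * y] plus that derivative. The terms in [Y] total at
    most [(n - 1) * pi]. The angle terms total [position_angle s (- T) - position_angle s T] plus
    twice the increment from [u] to [v], which [hp] bounds by [pi]. *)
Lemma turning_pieces (T u v : R) : - T <= u -> u <= v -> v <= T ->
  (forall t, - T < t < u -> 0 <= expsum s 1 t * dgram s t) ->
  (forall t, u < t < v -> expsum s 1 t * dgram s t <= 0) ->
  (forall t, v < t < T -> 0 <= expsum s 1 t * dgram s t) ->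
  position_angle s v - position_angle s u <= pi / 2 ->
  (\int[mu]_(t in `[(- T)%R, T]) `|turning s t|%:E <=
   (((size s)%:R - 1) * pi + pi + position_angle s (- T) - position_angle s T)%:E)%E.
Proof.
move=> Tu uv vT h1 h2 h3 hp.
have [|Y [y [dY cy y0 yE Yb]]] := spherical_length_majorant s _ hs.
  by case: dom; case: s.
have ct := continuous_turning.
have mf : measurable_fun setT (fun t => `|turning s t|).
  by apply: continuous_measurable_fun; exact: continuous_norm.
have cd : continuous (fun t => Num.sqrt (gram s t) / expsum s 0 t).
  apply: continuous_mul; first by apply: continuous_sqrt; exact: continuous_gram.
  by apply: continuous_inv; [move=> t; rewrite gt_eqF | exact: continuous_expsum].
pose w t := Num.sqrt (gram s t) / expsum s 0 t.
have w0 t : 0 <= w t by rewrite divr_ge0 ?sqrtr_ge0 // ltW.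
have dpsi t : is_derive t 1 (position_angle s) (w t - turning s t).
  exact: is_derive_position_angle.
have cw : continuous (fun t => w t - turning s t).
  by apply: continuous_add => //; exact: continuous_opp.
have d2Y t : is_derive t 1 (fun x => 2 * Y x) (2 * y t).
  have h := is_derive_mul (is_derive_cst1 2 t) (dY t).
  by apply: (is_derive_val h); rewrite mul0r add0r.
have dYp t : is_derive t 1 (fun x => 2 * Y x + position_angle s x) (2 * y t + (w t - turning s t)).
  exact: (is_derive_add (d2Y t) (dpsi t)).
have dYm t : is_derive t 1 (fun x => 2 * Y x - position_angle s x) (2 * y t - (w t - turning s t)).
  exact: (is_derive_add (d2Y t) (is_derive_opp (dpsi t))).
have c2y : continuous (fun t => 2 * y t) by apply: continuous_mul => //; exact: continuous_cst1.
have outer p q : p <= q -> (forall t, p < t < q -> 0 <= expsum s 1 t * dgram s t) ->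
  (\int[mu]_(t in `[p, q]) `|turning s t|%:E <=
   (2 * Y q - position_angle s q - (2 * Y p - position_angle s p))%:E)%E.
  move=> pq h; apply: (integral_le_increment _ _ _ _ _ pq mf _ dYm) => //.
    by apply: continuous_add => //; exact: continuous_opp.
  move=> x /h/(turning_sign x).1 k; rewrite ger0_norm //.
  by have := yE x; rewrite -/(w x); lra.
have inner p q : p <= q -> (forall t, p < t < q -> expsum s 1 t * dgram s t <= 0) ->
  (\int[mu]_(t in `[p, q]) `|turning s t|%:E <=
   (2 * Y q + position_angle s q - (2 * Y p + position_angle s p))%:E)%E.
  move=> pq h; apply: (integral_le_increment _ _ _ _ _ pq mf _ dYp) => //.
    exact: continuous_add.
  move=> x /h/(turning_sign x).2 k; rewrite ler0_norm //.
  by have := y0 x; have := w0 x; lra.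
rewrite (integral_itv_split _ _ u) ?(le_trans uv) // (integral_itv_split _ u v) //.
apply: (le_trans (leeD (outer _ _ Tu h1) (leeD (inner _ _ uv h2) (outer _ _ vT h3)))).
by rewrite -!EFinD lee_fin; have := Yb (- T) T; lra.
Qed.

(** The middle piece runs between a zero [z] of [expsum s 1] and a sign change of [dgram], or an end
    of the interval if there is none. The angle vanishes at [z], so its increment over that piece is
    below [pi / 2] rather than [pi]. *)
Lemma turning_integral_itv (T : R) : 0 <= T ->
  expsum s 1 (- T) <= 0 -> 0 <= expsum s 1 T ->
  (\int[mu]_(t in `[(- T)%R, T]) `|turning s t|%:E <=
   (((size s)%:R - 1) * pi + pi + position_angle s (- T) - position_angle s T)%:E)%E.
Proof.
move=> T0 hl hr; have TT : - T <= T by lra.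
have ivt (f : R -> R) a b : continuous f -> a <= b -> f a <= 0 -> 0 <= f b ->
    exists c, [/\ a <= c, c <= b & f c = 0].
  move=> cf ab fa fb; have [|c] := @IVT R f a b 0 ab (continuous_subspaceT cf).
    by rewrite ge_min fa /= le_max fb orbT.
  by rewrite in_itv /= => /andP[? ?] ?; exists c.
have [z [Tz zT az]] := ivt _ _ _ (@continuous_expsum R s 1) TT hl hr.
have aneg t : t <= z -> expsum s 1 t <= 0 by move=> ?; rewrite -az expsum1_nondecreasing.
have apos t : z <= t -> 0 <= expsum s 1 t by move=> ?; rewrite -az expsum1_nondecreasing.
have pz : position_angle s z = 0 by rewrite /position_angle az mul0r atan0.
have [Dz|Dz] := leP (dgram s z) 0.
- have [v [zv vT Dv1 Dv2]] : exists v, [/\ z <= v, v <= T,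
      forall t, t < v -> dgram s t <= 0 & forall t, v < t < T -> 0 <= dgram s t].
    have [DT|DT] := leP (dgram s T) 0.
      exists T; split => //.
        by move=> t tT; apply: le_trans DT; exact: dgram_nondecreasing (ltW tT).
      by move=> t /andP[h1 h2]; move: (lt_trans h1 h2); rewrite ltxx.
    have [v [zv vT Dv]] := ivt _ _ _ (@continuous_dgram R s) zT Dz (ltW DT).
    exists v; split => // t; first by move=> tv; rewrite -Dv dgram_nondecreasing // ltW.
    by move=> /andP[vt _]; rewrite -Dv dgram_nondecreasing // ltW.
  apply: (turning_pieces T z v) => //.
  + move=> t /andP[_ tz]; apply: mulr_le0; first exact: aneg (ltW tz).
    by apply: le_trans Dz; exact: dgram_nondecreasing (ltW tz).
  + move=> t /andP[zt tv]; apply: mulr_ge0_le0; [exact: apos (ltW zt) | exact: Dv1].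
  + move=> t /andP[vt tT]; apply: mulr_ge0; last by apply: Dv2; rewrite vt.
    by apply: apos; exact: le_trans zv (ltW vt).
  + by rewrite pz subr0 ltW //; have /andP[] := position_angle_bound v.
- have [u [Tu uz Du1 Du2]] : exists u, [/\ - T <= u, u <= z,
      forall t, u < t -> 0 <= dgram s t & forall t, - T < t < u -> dgram s t <= 0].
    have [DT|DT] := leP 0 (dgram s (- T)).
      exists (- T); split => //.
        by move=> t tT; apply: le_trans DT _; exact: dgram_nondecreasing (ltW tT).
      by move=> t /andP[h1 h2]; move: (lt_trans h1 h2); rewrite ltxx.
    have [u [Tu uz Du]] := ivt _ _ _ (@continuous_dgram R s) Tz (ltW DT) (ltW Dz).
    exists u; split => // t; first by move=> tu; rewrite -Du dgram_nondecreasing // ltW.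
    by move=> /andP[_ tu]; rewrite -Du dgram_nondecreasing // ltW.
  apply: (turning_pieces T u z) => //.
  + move=> t /andP[Tt tu]; apply: mulr_le0; last by apply: Du2; rewrite Tt.
    by apply: aneg; exact: le_trans (ltW tu) uz.
  + by move=> t /andP[ut tz]; apply: mulr_le0_ge0; [exact: aneg (ltW tz) | exact: Du1].
  + move=> t /andP[zt tT]; apply: mulr_ge0; first exact: apos (ltW zt).
    by apply: le_trans (ltW Dz) _; exact: dgram_nondecreasing (ltW zt).
  + rewrite pz sub0r; have /andP[h _] := position_angle_bound u; lra.
Qed.

End Fixed.

Definition eventually_small (f : R -> R) :=
  forall k, 0 < k -> \forall t \near +oo, f t <= k.

Lemma eventually_small_exp (c : R) : c < 0 -> eventually_small (fun t => expR (c * t)).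
Proof.
move=> c0 k k0; near=> t.
have t1 : k^-1 / - c <= t by near: t; apply: nbhs_pinfty_ge; exact: num_real.
have h : k^-1 <= expR (- c * t).
  apply: le_trans (expR_ge1Dx _).
  by move: t1; rewrite ler_pdivrMr ?oppr_gt0 // => ?; lra.
rewrite -[c]opprK mulNr expRN -[k]invrK lef_pV2 ?posrE ?expR_gt0 // invr_gt0 //.
Unshelve. all: by end_near. Qed.

Lemma eventually_small_sum (s : seq R) (f : R -> R -> R) :
  (forall l, l \in s -> eventually_small (f l)) ->
  eventually_small (fun t => \sum_(l <- s) f l t).
Proof.
elim: s => [|l s IH] h k k0.
  by near=> t; rewrite big_nil ltW.
have k2 : 0 < k / 2 by rewrite divr_gt0.
have h1 := h l (mem_head _ _) _ k2.
have {}IH := IH (fun m ms => h m (mem_behead (s := l :: s) ms)) _ k2.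
near=> t; rewrite big_cons (splitr k) lerD //; near: t; [exact: h1 | exact: IH].
Unshelve. all: by end_near. Qed.

Lemma eventually_smallZ (c : R) (f : R -> R) : 0 <= c -> eventually_small f ->
  eventually_small (fun t => c * f t).
Proof.
move=> c0 hf k k0; have c1 : 0 < c + 1 by rewrite ltr_wpDl.
have := hf _ (divr_gt0 k0 c1); apply: filterS => t ft.
apply: (le_trans (ler_wpM2l c0 ft)).
by rewrite mulrA ler_pdivrMr // mulrC ler_wpM2l ?ltW // ltrDl.
Qed.

(** In [gramE] the diagonal pairs have weight zero, and any other pair satisfies
    [l + m < 2 * top]. *)
Lemma gram_eventually_small s top bot : dominant_in s top bot ->
  eventually_small (fun t => gram s t * expR (- (2 * top) * t)).
Proof.
move=> [_ _ _ bd].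
have -> : (fun t => gram s t * expR (- (2 * top) * t)) =
    (fun t => 2^-1 * \sum_(l <- s) \sum_(m <- s) (l - m) ^+ 2 * expR ((l + m - 2 * top) * t)).
  apply/funext => t; have -> : gram s t = 2^-1 * (2 * gram s t) by field.
  rewrite gramE -mulrA; congr (_ * _); rewrite mulr_suml; apply: eq_bigr => l _.
  rewrite mulr_suml; apply: eq_bigr => m _; rewrite -mulrA -expRD.
  by congr (_ * expR _); ring.
apply: eventually_smallZ => //; apply: eventually_small_sum => l ls.
apply: eventually_small_sum => m ms.
have [->|lm] := eqVneq l m.
  by move=> k k0; near=> t; rewrite subrr expr0n mul0r ltW.
apply: eventually_smallZ; first exact: sqr_ge0.
apply: eventually_small_exp.
have /andP[_ h1] := bd _ ls; have /andP[_ h2] := bd _ ms.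
move: lm; rewrite neq_lt => /orP[?|?]; lra.
Unshelve. all: by end_near. Qed.

Lemma expsum1_ge s top bot t : dominant_in s top bot -> 0 <= t ->
  top * expR (top * t) + (size s)%:R * bot <= expsum s 1 t.
Proof.
move=> [ts _ /andP[b0 t0] bd] t1; rewrite -lerBrDr.
apply: (@le_trans _ _ (\sum_(l <- s) (l * expR (l * t) - bot))); last first.
  rewrite sumrB big_const_seq count_predT iter_addr addr0 /expsum lerB //.
  by rewrite mulr_natl.
have ge0 l : l \in s -> 0 <= l * expR (l * t) - bot.
  move=> /bd/andP[bl _]; have [l0|l0] := leP 0 l.
    by rewrite subr_ge0 (le_trans (ltW b0)) // mulr_ge0 ?expR_ge0.
  rewrite subr_ge0 (le_trans bl) // -[leLHS]mulr1 ler_wnM2l ?(ltW l0) //.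
  by rewrite -expR0 ler_expR mulr_le0_ge0 // ltW.
rewrite (big_rem top ts) /=.
have : 0 <= \sum_(l <- rem top s) (l * expR (l * t) - bot).
  by rewrite big_seq; apply: sumr_ge0 => l /mem_rem/ge0.
lra.
Qed.

Lemma position_angle_limit s top bot : dominant_in s top bot ->
  forall e, 0 < e -> \forall T \near +oo,
    0 <= expsum s 1 T /\ pi / 2 - e <= position_angle s T.
Proof.
move=> dom e e0; have [_ _ /andP[b0 t0] _] := dom.
have [C0 [C1 atanC]] : exists C, 0 < C /\ pi / 2 - e <= atan C.
  have := @cvgy_atan R; move=> /cvgrPdist_lt /(_ _ e0) h.
  have [C [C0 hC]] : exists C : R, 0 < C /\ `|pi / 2 - atan C| < e.
    have : \forall C \near +oo, 0 < C /\ `|pi / 2 - atan C| < e :> R.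
      by near=> C; split; [near: C; apply: nbhs_pinfty_gt; exact: num_real | near: C; exact: h].
    by move/filter_ex => [C hC]; exists C.
  exists C; split => //; move: hC; rewrite ltr_norml => /andP[_ ?]; lra.
(* Chosen so that eventually [sqrt gram <= top / (2 * C0) * expR (top * T)]; with
   [expsum s 1 >= top / 2 * expR (top * T)] the ratio is at least [C0]. *)
have k0 : 0 < (top / (2 * C0)) ^+ 2 by rewrite exprn_gt0 // divr_gt0 // mulr_gt0.
have hs := gram_eventually_small _ _ _ dom _ k0.
have he := eventually_small_exp (- top) (_ : - top < 0).
pose n1 := (size s)%:R * (- bot) + 1.
have n10 : 0 < n1 by rewrite /n1 ltr_wpDl // mulr_ge0 // oppr_ge0 ltW.
have {}he := he (ltac:(by rewrite oppr_lt0)) (top / (2 * n1)) (ltac:(by rewrite divr_gt0 // mulr_gt0)).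
near=> T.
have T0 : 0 <= T by near: T; apply: nbhs_pinfty_ge; exact: num_real.
have a1 := expsum1_ge s top bot T dom T0.
have eE : 0 < expR (top * T) by exact: expR_gt0.
have h1 : expR (- top * T) <= top / (2 * n1) by near: T; exact: he.
have h2 : gram s T * expR (- (2 * top) * T) <= (top / (2 * C0)) ^+ 2 by near: T; exact: hs.
rewrite mulNr expRN in h1; rewrite mulNr expRN -mulrA in h2.
have e2 : expR (2 * (top * T)) = expR (top * T) ^+ 2 by rewrite -expRM_natl.
rewrite e2 in h2; move: (expR (top * T)) eE a1 h1 h2 => E eE a1 h1 h2.
have b1 : n1 <= top / 2 * E.
  have : E^-1 * (2 * n1) <= top by rewrite -ler_pdivlMr // mulr_gt0.
  by rewrite mulrC ler_pdivrMr // => ?; lra.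
have b2 : top / 2 * E <= expsum s 1 T.
  apply: le_trans a1; move: b1; rewrite /n1; lra.
have p0 : 0 < top / 2 * E by rewrite mulr_gt0 // divr_gt0.
split; first by apply: le_trans b2; exact: ltW.
apply: (le_trans atanC); apply: le_atan.
have D0 := dominant_gram_gt0 _ _ _ dom T.
rewrite ler_pdivlMr ?sqrtr_gt0 //; apply: le_trans b2.
have Cd : 0 <= top / (2 * C0) * E by rewrite mulr_ge0 ?divr_ge0 ?mulr_ge0 // ltW.
have : Num.sqrt (gram s T) <= top / (2 * C0) * E.
  rewrite -(ger0_norm Cd) -sqrtr_sqr; apply: ler_wsqrtr.
  by rewrite exprMn -ler_pdivrMr ?exprn_gt0.
move=> /(ler_wpM2l (ltW C1)); have -> // : C0 * (top / (2 * C0) * E) = top / 2 * E.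
by field; rewrite gt_eqF.
Unshelve. all: by end_near. Qed.

Lemma position_angle_opp s t : position_angle (map -%R s) t = - position_angle s (- t).
Proof.
by rewrite /position_angle gram_opp expsum_opp expr1 mulN1r mulNr atanN.
Qed.

Lemma turning_integral s top bot : dominant_in s top bot -> sorted >=%R s ->
  (\int[mu]_t `|turning s t|%:E <= (((size s)%:R - 1) * pi)%:E)%E.
Proof.
move=> dom hs; have dom' := dominant_in_opp _ _ _ dom.
apply/lee_addgt0Pr => e e0.
have mf : measurable_fun setT (fun t => `|turning s t|).
  by apply: continuous_measurable_fun; apply: continuous_norm; exact: continuous_turning dom.
apply: integral_setT_le => // T T0.
have e2 : 0 < e / 2 by rewrite divr_gt0.
have near1 := position_angle_limit _ _ _ dom _ e2.
have near2 := position_angle_limit _ _ _ dom' _ e2.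
(* The interval is enlarged until the end angles are within [e / 2] of [- pi / 2] and [pi / 2];
   their difference then cancels the extra [pi] up to [e]. *)
have [M [TM [[ha hp] [ha' hp']]]] : exists M, T <= M /\
    (0 <= expsum s 1 M /\ pi / 2 - e / 2 <= position_angle s M) /\
    (0 <= expsum (map -%R s) 1 M /\ pi / 2 - e / 2 <= position_angle (map -%R s) M).
  have : \forall M \near +oo, T <= M /\
    (0 <= expsum s 1 M /\ pi / 2 - e / 2 <= position_angle s M) /\
    (0 <= expsum (map -%R s) 1 M /\ pi / 2 - e / 2 <= position_angle (map -%R s) M).
    near=> M; split; first by near: M; apply: nbhs_pinfty_ge; exact: num_real.
    by split; near: M.
  by move/filter_ex.
have M0 := le_trans T0 TM.
move: ha' hp'; rewrite expsum_opp position_angle_opp expr1 mulN1r oppr_ge0 => ha' hp'.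
have h := turning_integral_itv _ _ _ dom hs M M0 ha' ha.
apply: (@le_trans _ _ (\int[mu]_(t in `[(- M)%R, M]) `|turning s t|%:E)%E).
  apply: ge0_subset_integral => //.
  - exact/measurable_EFinP/measurable_funTS.
  - move=> x /=; rewrite !in_itv /= => /andP[h1 h2].
    by rewrite (le_trans h2) // andbT (le_trans _ h1) // lerN2.
apply: (le_trans h); rewrite -EFinD lee_fin; lra.
Unshelve. all: by end_near. Qed.

End Turning.

                                             

(** * Curvature of the Hessian metric of a product, and the tensor surface *)

Section ProductHessianMetric.
Context {R : realType}.
Variables (a b : nat -> R -> R).
Hypothesis da : forall k (t : R), is_derive t 1 (a k) (a k.+1 t).
Hypothesis db : forall k (t : R), is_derive t 1 (b k) (b k.+1 t).

(** [zeroth] and [oneth] count the derivatives that an index contributes in the first and in the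
    second variable; with them the metric below is one quarter of the Hessian of [a 0 x * b 0 y]. *)
Definition zeroth (i : 'I_2) : nat := (i == 0).
Definition oneth (i : 'I_2) : nat := (i != 0).

                                             
Definition product_hessian (t : R * R) : 'M[R]_2 :=
  \matrix_(i, j) (4^-1 * a (zeroth i + zeroth j)%N t.1 * b (oneth i + oneth j)%N t.2).

Local Notation G := product_hessian.

Definition hessian_det (x y : R) := a 0 x * a 2 x * b 0 y * b 2 y - a 1 x ^+ 2 * b 1 y ^+ 2.

Hypothesis det_gt0 : forall x y, 0 < hessian_det x y.

Lemma ord2E (i : 'I_2) : i = 0 \/ i = 1.
Proof. by case: i => [[|[|//]] h]; [left|right]; exact: val_inj. Qed.

Lemma invmx2E (M : 'M[R]_2) : M 0 0 * M 1 1 - M 0 1 * M 1 0 != 0 ->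
  invmx M = (M 0 0 * M 1 1 - M 0 1 * M 1 0)^-1 *:
    \matrix_(i, j) (if i == j then M (1 - i) (1 - j) else - M i j).
Proof.
move=> dM; set N := _ *: _.
have MN : M *m N = 1%:M.
  apply/matrixP => i j; rewrite !mxE !big_ord_recl big_ord0 !mxE /=.
  have e1 : lift ord0 ord0 = 1 :> 'I_2 by exact: val_inj.
  have e2 : 1 - 1 = 0 :> 'I_2 by exact: val_inj.
  have e3 : 1 - 0 = 1 :> 'I_2 by exact: val_inj.
  have e4 : ord0 = 0 :> 'I_2 by exact: val_inj.
  rewrite e1 e4; case: (ord2E i) => ->; case: (ord2E j) => -> /=;
    rewrite ?e2 ?e3 ?eqxx /=; by field.
have [uM _] := mulmx1_unit MN.
by rewrite -[RHS]mul1mx -(mulVmx uM) -mulmxA MN mulmx1.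
Qed.

Lemma partial_product_hessian (k i j : 'I_2) (t : R * R) :
  partial k (fun u => G u i j) t =
  4^-1 * a (zeroth k + (zeroth i + zeroth j))%N t.1
       * b (oneth k + (oneth i + oneth j))%N t.2.
Proof.
rewrite /partial; case: ifPn => k0; rewrite derive1E [zeroth k]/zeroth [oneth k]/oneth k0 /= ?add0n ?add1n.
- have h := is_derive_mul (is_derive_mul (is_derive_cst1 4^-1 t.1)
    (da (zeroth i + zeroth j)%N t.1))
    (is_derive_cst1 (b (oneth i + oneth j)%N t.2) t.1).
  under eq_fun do rewrite /product_hessian mxE /=.
  by rewrite (@derive_val _ _ _ _ _ _ _ h) /= mulr0 addr0 mul0r add0r.
- rewrite (negbTE k0) add0n.
  have h := is_derive_mul (is_derive_cst1 (4^-1 * a (zeroth i + zeroth j)%N t.1) t.2)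
    (db (oneth i + oneth j)%N t.2).
  under eq_fun do rewrite /product_hessian mxE /=.
  by rewrite (@derive_val _ _ _ _ _ _ _ h) /= mul0r add0r.
Qed.

                                                                           
                      
Definition hessian_christoffel (l i j : 'I_2) (x y : R) : R :=
  let F (k : 'I_2) := a (zeroth k + (zeroth i + zeroth j))%N x
    * b (oneth k + (oneth i + oneth j))%N y in
  2^-1 * (if l == 0 then a 0 x * b 2 y * F 0 - a 1 x * b 1 y * F 1
          else a 2 x * b 0 y * F 1 - a 1 x * b 1 y * F 0) / hessian_det x y.

Lemma christoffel_product_hessian (l i j : 'I_2) (t : R * R) :
  christoffel G l i j t = hessian_christoffel l i j t.1 t.2.
Proof.
rewrite /christoffel.
(* The first derivatives of a Hessian metric are third derivatives of its potential, hence symmetric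
   in all indices, so two of the three terms cancel. *)
have F k : partial i (fun u => G u j k) t + partial j (fun u => G u i k) t
    - partial k (fun u => G u i j) t = partial k (fun u => G u i j) t.
  rewrite !partial_product_hessian.
  have -> : (zeroth i + (zeroth j + zeroth k) = zeroth k + (zeroth i + zeroth j))%N.
    by rewrite addnA addnC.
  have -> : (oneth i + (oneth j + oneth k) = oneth k + (oneth i + oneth j))%N.
    by rewrite addnA addnC.
  have -> : (zeroth j + (zeroth i + zeroth k) = zeroth k + (zeroth i + zeroth j))%N.
    by rewrite addnA addnC [(zeroth j + _)%N]addnC.
  have -> : (oneth j + (oneth i + oneth k) = oneth k + (oneth i + oneth j))%N.
    by rewrite addnA addnC [(oneth j + _)%N]addnC.
  by rewrite addrK.
under eq_bigr do rewrite F.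
have e1 : lift ord0 ord0 = 1 :> 'I_2 by exact: val_inj.
have e4 : ord0 = 0 :> 'I_2 by exact: val_inj.
have e2 : 1 - 1 = 0 :> 'I_2 by exact: val_inj.
have e3 : 1 - 0 = 1 :> 'I_2 by exact: val_inj.
rewrite !big_ord_recl big_ord0 e1 e4 !partial_product_hessian.
have d0 := lt0r_neq0 (det_gt0 t.1 t.2).
have gd : G t 0 0 * G t 1 1 - G t 0 1 * G t 1 0 = hessian_det t.1 t.2 / 16.
  by rewrite !mxE /= /hessian_det; field.
rewrite invmx2E; last by rewrite gd mulf_neq0 // invr_neq0.
rewrite gd !mxE /hessian_christoffel.
have z0 : zeroth 0 = 1%N by [].
have z1 : zeroth 1 = 0%N by [].
have o0 : oneth 0 = 0%N by [].
have o1 : oneth 1 = 1%N by [].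
case: (ord2E l) => -> /=; rewrite ?e2 ?e3 ?eqxx ?z0 ?z1 ?o0 ?o1 ?add0n ?add1n;
  move: (hessian_det _ _) d0 => d d0; by field.
Qed.

Lemma is_derive_quot (f g : R -> R) (t df dg : R) : is_derive t 1 f df ->
  is_derive t 1 g dg -> g t != 0 ->
  is_derive t 1 (fun x => f x / g x) ((df * g t - f t * dg) / g t ^+ 2).
Proof.
move=> hf hg g0; apply: (is_derive_val (is_derive_mul hf (is_derive_inv hg g0))).
by field.
Qed.

Definition product_curvature x y : R :=
  let D := a 0 x * a 2 x - a 1 x ^+ 2 in
  let dD := a 0 x * a 3 x - a 1 x * a 2 x in
  let E := b 0 y * b 2 y - b 1 y ^+ 2 in
  let dE := b 0 y * b 3 y - b 1 y * b 2 y in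
  - (b 1 y * dE * (2 * a 2 x * D - a 1 x * dD)
     + a 1 x * dD * (2 * b 2 y * E - b 1 y * dE)) / (2 * hessian_det x y ^+ 2).

Lemma gauss_curvature_product_hessian (t : R * R) :
  gauss_curvature G t = product_curvature t.1 t.2.
Proof.
have e1 : lift ord0 ord0 = 1 :> 'I_2 by exact: val_inj.
have e4 : ord0 = 0 :> 'I_2 by exact: val_inj.
have chr l i j : christoffel G l i j = fun u => hessian_christoffel l i j u.1 u.2.
  by apply/funext => u; exact: christoffel_product_hessian.
case: t => x y; have d0 := lt0r_neq0 (det_gt0 x y).
have dx : is_derive x 1 (fun x => hessian_det x y)
    ((a 1 x * a 2 x + a 0 x * a 3 x) * b 0 y * b 2 y - 2 * a 1 x * a 2 x * b 1 y ^+ 2).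
  have c k := is_derive_cst1 (b k y) x.
  apply: (is_derive_val (is_derive_add (is_derive_mul (is_derive_mul
    (is_derive_mul (da 0 x) (da 2%N x)) (c 0)) (c 2%N))
    (is_derive_opp (is_derive_mul (is_derive_sqr (da 1 x)) (is_derive_sqr (c 1)))))).
  by ring.
have dy : is_derive y 1 (fun y => hessian_det x y)
    (a 0 x * a 2 x * (b 1 y * b 2 y + b 0 y * b 3 y) - 2 * a 1 x ^+ 2 * b 1 y * b 2 y).
  have c k := is_derive_cst1 (a k x) y.
  apply: (is_derive_val (is_derive_add (is_derive_mul (is_derive_mul
    (is_derive_mul (c 0) (c 2%N)) (db 0 y)) (db 2%N y))
    (is_derive_opp (is_derive_mul (is_derive_sqr (c 1)) (is_derive_sqr (db 1 y)))))).
  by ring.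
have p0 (f : R * R -> R) : partial 0 f (x, y) = derive1 (fun x => f (x, y)) x by [].
have p1 (f : R * R -> R) : partial 1 f (x, y) = derive1 (fun y => f (x, y)) y by [].
have dval (f : R -> R) (z df : R) : is_derive z 1 f df -> derive1 f z = df.
  by move=> h; rewrite derive1E (@derive_val _ _ _ _ _ _ _ h).
have cb k := is_derive_cst1 (b k y) x.
have ca k := is_derive_cst1 (a k x) y.
have half (z : R) := is_derive_cst1 2^-1 z.
(* The four derivatives of Christoffel symbols entering [riemann l 1 0 1]. They involve derivatives
   of [a] and [b] of order at most 3, and the curvature formula becomes a rational identity in eight
   variables. *)
have P0 := dval (fun z => hessian_christoffel 0 1 1 z y) x _ (is_derive_quot _ _ _ _ _ (is_derive_mul (half x) (is_derive_add
    (is_derive_mul (is_derive_mul (da 0 x) (cb 2%N)) (is_derive_mul (da 1 x) (cb 2%N)))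
    (is_derive_opp (is_derive_mul (is_derive_mul (da 1 x) (cb 1)) (is_derive_mul (da 0 x) (cb 3%N)))))) dx d0).
have P1 := dval (fun z => hessian_christoffel 0 0 1 x z) y _ (is_derive_quot _ _ _ _ _ (is_derive_mul (half y) (is_derive_add
    (is_derive_mul (is_derive_mul (ca 0) (db 2%N y)) (is_derive_mul (ca 2%N) (db 1 y)))
    (is_derive_opp (is_derive_mul (is_derive_mul (ca 1) (db 1 y)) (is_derive_mul (ca 1) (db 2%N y)))))) dy d0).
have P2 := dval (fun z => hessian_christoffel 1 1 1 z y) x _ (is_derive_quot _ _ _ _ _ (is_derive_mul (half x) (is_derive_add
    (is_derive_mul (is_derive_mul (da 2%N x) (cb 0)) (is_derive_mul (da 0 x) (cb 3%N)))
    (is_derive_opp (is_derive_mul (is_derive_mul (da 1 x) (cb 1)) (is_derive_mul (da 1 x) (cb 2%N)))))) dx d0).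
have P3 := dval (fun z => hessian_christoffel 1 0 1 x z) y _ (is_derive_quot _ _ _ _ _ (is_derive_mul (half y) (is_derive_add
    (is_derive_mul (is_derive_mul (ca 2%N) (db 0 y)) (is_derive_mul (ca 1) (db 2%N y)))
    (is_derive_opp (is_derive_mul (is_derive_mul (ca 1) (db 1 y)) (is_derive_mul (ca 2%N) (db 1 y)))))) dy d0).
have pc0 l : partial 0 (christoffel G l 1 1) (x, y) =
    derive1 (fun z => hessian_christoffel l 1 1 z y) x by rewrite p0 chr.
have pc1 l : partial 1 (christoffel G l 0 1) (x, y) =
    derive1 (fun z => hessian_christoffel l 0 1 x z) y by rewrite p1 chr.
rewrite /gauss_curvature !big_ord_recl big_ord0 e1 e4 /riemann.
rewrite !pc0 !pc1 P0 P1 P2 P3 !big_ord_recl !big_ord0 e1 e4 !chr.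
rewrite /product_curvature /hessian_christoffel !mxE /=.
have z0 : zeroth 0 = 1%N by [].
have z1 : zeroth 1 = 0%N by [].
have o0 : oneth 0 = 0%N by [].
have o1 : oneth 1 = 1%N by [].
rewrite !z0 !z1 !o0 !o1 ?add0n ?addn0 ?add1n.
move: d0; rewrite /hessian_det.
move: (a 0 x) (a 1 x) (a 2 x) (a 3 x) (b 0 y) (b 1 y) (b 2 y) (b 3 y).
move=> {P0 P1 P2 P3} a0 a1 a2 a3 b0 b1 b2 b3 d0.
have -> : 4^-1 * a2 * b0 * (4^-1 * a0 * b2) - (4^-1 * a1 * b1) ^+ 2 =
  (a0 * a2 * b0 * b2 - a1 ^+ 2 * b1 ^+ 2) / 16 by field.
by field; rewrite exprMn.
Qed.

Lemma vol_density_product_hessian (t : R * R) :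
  vol_density G t = Num.sqrt (hessian_det t.1 t.2) / 4.
Proof.
rewrite /vol_density !mxE /=.
rewrite [X in Num.sqrt X](_ : _ = hessian_det t.1 t.2 * 4^-1 ^+ 2); last first.
  by rewrite /hessian_det; field.
by rewrite sqrtrM ?ltW // sqrtr_sqr ger0_norm.
Qed.

End ProductHessianMetric.

Section TensorSurface.
Context {R : realType}.
Variables (n1 n2 : nat) (r : n1.-tuple R) (s : n2.-tuple R).

(** Inner products of derivatives of an exponential curve are exponential sums in the doubled roots;
    the powers of 2 are compensated by the factor 1/4 in [product_hessian]. *)
Definition doubled n (q : n.-tuple R) : seq R := [seq 2 * x | x <- q].

Lemma expsum_doubled n (q : n.-tuple R) k t :
  expsum (doubled n q) k t = \sum_i (2 * tnth q i) ^+ k * expR (tnth q i * t) ^+ 2.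
Proof.
rewrite /expsum big_map big_tuple; apply: eq_bigr => i _.
by rewrite -expRM_natl mulrA.
Qed.

Lemma partial_tensor_surface (k : 'I_2) (t : R * R) :
  partial k (tensor_surface r s) t =
  mxvec (\matrix_(i, j) ((if k == 0 then tnth r i else tnth s j)
    * (expR (tnth r i * t.1) * expR (tnth s j * t.2)))).
Proof.
rewrite /partial; case: ifPn => k0; rewrite derive1E.
- have d i (j : 'I_(n1 * n2)) : is_derive t.1 1 (fun x => tensor_surface r s (x, t.2) i j)
    (mxvec (\matrix_(i, j) (tnth r i * (expR (tnth r i * t.1) * expR (tnth s j * t.2)))) i j).
    case/mxvec_indexP: j => p q; rewrite ord1 mxvecE mxE.
    have -> : (fun x => tensor_surface r s (x, t.2) 0 (mxvec_index p q)) =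
      (fun x => expR (tnth r p * x) * expR (tnth s q * t.2)).
      by apply/funext => x; rewrite /tensor_surface /tensor mxvecE !mxE.
    apply: (is_derive_val (is_derive_mul (is_derive_exp _ _) (is_derive_cst1 _ _))).
    by rewrite mulr0 addr0 mulrA.
  rewrite derive_mx; last by apply/derivable_mxP => i j; have [] := d i j.
  by apply/matrixP => i j; rewrite mxE (@derive_val _ _ _ _ _ _ _ (d i j)).
- have d i (j : 'I_(n1 * n2)) : is_derive t.2 1 (fun y => tensor_surface r s (t.1, y) i j)
    (mxvec (\matrix_(i, j) (tnth s j * (expR (tnth r i * t.1) * expR (tnth s j * t.2)))) i j).
    case/mxvec_indexP: j => p q; rewrite ord1 mxvecE mxE.
    have -> : (fun y => tensor_surface r s (t.1, y) 0 (mxvec_index p q)) =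
      (fun y => expR (tnth r p * t.1) * expR (tnth s q * y)).
      by apply/funext => x; rewrite /tensor_surface /tensor mxvecE !mxE.
    apply: (is_derive_val (is_derive_mul (is_derive_cst1 _ _) (is_derive_exp _ _))).
    by rewrite mul0r add0r; ring.
  rewrite derive_mx; last by apply/derivable_mxP => i j; have [] := d i j.
  by apply/matrixP => i j; rewrite mxE (@derive_val _ _ _ _ _ _ _ (d i j)).
Qed.

Lemma dotprod_mxvec (A B : 'M[R]_(n1, n2)) :
  dotprod (mxvec A) (mxvec B) = \sum_i \sum_j A i j * B i j.
Proof.
rewrite /dotprod (reindex _ (curry_mxvec_bij _ _)) /= pair_bigA /=.
by apply: eq_bigr => -[i j] _; rewrite /= !mxvecE.
Qed.

Lemma induced_metric_tensor_surface :
  induced_metric (tensor_surface r s) =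
  product_hessian (expsum (doubled n1 r)) (expsum (doubled n2 s)).
Proof.
apply/funext => t; apply/matrixP => k l; rewrite !mxE.
rewrite !partial_tensor_surface dotprod_mxvec !expsum_doubled.
rewrite -mulrA big_distrlr /= mulr_sumr; apply: eq_bigr => i _.
rewrite mulr_sumr; apply: eq_bigr => j _; rewrite !mxE /zeroth /oneth.
by case: (k == 0); case: (l == 0); rewrite /= ?addn0 ?add0n ?addn1 /=; field.
Qed.

End TensorSurface.

                            

(** * Numerical estimates *)

Section NumericBounds.
Context {R : realType}.

Lemma atan_le_id (x : R) : 0 <= x -> atan x <= x.
Proof.
move=> x0; rewrite -subr_ge0.
have d (t : R) : is_derive t 1 (fun x : R => x - atan x) (1 - 1 / (1 + t ^+ 2)).
  exact: (is_derive_add (is_derive_id t 1) (is_derive_opp (is_derive_atan (is_derive_id t 1)))).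
have p t : 0 <= 1 - 1 / (1 + t ^+ 2) :> R.
  by rewrite subr_ge0 ler_pdivrMr ?mul1r ?lerDl ?sqr_ge0 // ltr_wpDr ?sqr_ge0.
by have := derive_ge0_le _ _ _ _ d p x0; rewrite atan0 subr0.
Qed.

(** Since [pi / 4 = atan (1/2) + atan (1/3)], it is at most [1/2 + 1/3 = 5/6]. *)
Lemma pi_le : pi <= 10 / 3 :> R.
Proof.
have ca (x : R) : cos (atan x) != 0.
  by rewrite cos_atan invr_neq0 // sqrtr_eq0 -ltNge ltr_wpDr ?sqr_ge0.
have h1 : atan 2^-1 <= 2^-1 :> R by exact: atan_le_id.
have h2 : atan 3^-1 <= 3^-1 :> R by exact: atan_le_id.
have p2 : 1 <= pi / 2 :> R by exact: pihalf_ge1.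
have h3 : 0 <= atan 2^-1 :> R by rewrite -atan0 le_atan.
have h4 : 0 <= atan 3^-1 :> R by rewrite -atan0 le_atan.
have e : tan (atan 2^-1 + atan 3^-1) = 1 :> R.
  by rewrite tanD // !atanK; field.
have : atan (tan (atan 2^-1 + atan 3^-1)) = atan 2^-1 + atan 3^-1 :> R.
  apply: tanK; rewrite in_itv /=; apply/andP; split; lra.
rewrite e atan1; lra.
Qed.

(** A linear bound based at 5: [expR 2 >= (3/2) ^+ 4 >= 5] and [expR (n / 5 - 1) >= n / 5]. *)
Lemma ln_nat_le (n : nat) : (0 < n)%N -> ln n%:R <= n%:R / 5 + 1 :> R.
Proof.
move=> n0; have n0' : 0 < n%:R :> R by rewrite ltr0n.
rewrite -[leRHS]expRK ler_ln ?posrE ?expR_gt0 //.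
have e1 : 5 <= expR 2 :> R.
  have h : 3 / 2 <= expR (1 / 2) :> R by apply: le_trans (expR_ge1Dx _); lra.
  have -> : (2 : R) = 4%:R * (1 / 2) by field.
  rewrite expRM_natl; apply: (@le_trans _ _ ((3 / 2) ^+ 4)); first lra.
  by rewrite ler_pXn2r // nnegrE ?expR_ge0 //; lra.
have -> : n%:R / 5 + 1 = 2 + (n%:R / 5 - 1) :> R by ring.
rewrite expRD; apply: (@le_trans _ _ (5 * (n%:R / 5))); first by rewrite mulrCA divff ?mulr1.
apply: ler_pM => //.
by apply: le_trans (expR_ge1Dx _); lra.
Qed.

(** [n - 1 + ln n <= 6 n / 5], and [6/5 * 10/3 = 4], so the two products are at most [4 x (y - 1)]
    and [4 y (x - 1)]; the mixed term [8 x y] is at most [4 x^2 + 4 y^2]. *)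
Lemma numeric_bound (n1 n2 : nat) : (2 <= n1)%N -> (2 <= n2)%N ->
  (n1%:R - 1 + ln n1%:R) * ((n2%:R - 1) * pi)
  + (n2%:R - 1 + ln n2%:R) * ((n1%:R - 1) * pi) <=
  2 * pi + 4 * n1%:R * (n1%:R - 1) + 4 * n2%:R * (n2%:R - 1) :> R.
Proof.
move=> h1 h2; have l1 := ln_nat_le n1 (ltnW h1); have l2 := ln_nat_le n2 (ltnW h2).
have {h1} : 2 <= n1%:R :> R by rewrite ler_nat.
have {h2} : 2 <= n2%:R :> R by rewrite ler_nat.
move: (n1%:R : R) (n2%:R : R) l1 l2 => x y l1 l2 y2 x2.
have pi0 := @pi_ge0 R; have pi1 := pi_le.
have k (u v : R) : ln u <= u / 5 + 1 -> 2 <= u -> 2 <= v ->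
    (u - 1 + ln u) * ((v - 1) * pi) <= 4 * u * (v - 1).
  move=> lu u2 v2; apply: (@le_trans _ _ ((6 / 5 * u) * ((v - 1) * pi))).
    by apply: ler_wpM2r; [rewrite mulr_ge0 //; lra | lra].
  have -> : 4 * u * (v - 1) = 6 / 5 * u * ((v - 1) * (10 / 3)) by field.
  by apply: ler_wpM2l; [lra | apply: ler_wpM2l => //; lra].
have := k _ _ l1 x2 y2; have := k _ _ l2 y2 x2; have := sqr_ge0 (x - y).
rewrite !expr2; nra.
Qed.

End NumericBounds.

(** * Factorization of the curvature density and assembly *)

Section Tonelli.
Context {R : realType}.
Local Notation mu := (@lebesgue_measure R).

Lemma iterated_integral_le (M : R -> R) (V : R -> R -> R) (B C : R) :
  0 <= C -> (forall u, 0 <= M u) -> (forall u v, 0 <= V u v) ->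
  measurable_fun setT M -> (forall u, measurable_fun setT (V u)) ->
  measurable_fun setT (fun u => \int[mu]_v (M u * V u v)%:E)%E ->
  (forall u, \int[mu]_v (V u v)%:E <= C%:E)%E ->
  (\int[mu]_u (M u)%:E <= B%:E)%E ->
  (\int[mu]_u \int[mu]_v (M u * V u v)%:E <= (C * B)%:E)%E.
Proof.
move=> C0 M0 V0 mM mV mI hV hM.
apply: (@le_trans _ _ (\int[mu]_u (C%:E * (M u)%:E))%E); last first.
  rewrite ge0_integralZl_EFin //; last 2 first.
  - by move=> u _; rewrite lee_fin.
  - exact/measurable_EFinP.
  by rewrite EFinM lee_wpmul2l.
apply: ge0_le_integral => //.
- by move=> u _; apply: integral_ge0 => v _; rewrite lee_fin mulr_ge0.
- by apply/measurable_EFinP; exact: measurable_funM.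
- move=> u _; under eq_integral do rewrite EFinM.
  rewrite ge0_integralZl_EFin //; last 2 first.
  - by move=> v _; rewrite lee_fin.
  - by apply/measurable_EFinP; exact: mV.
  by rewrite muleC lee_wpmul2r // lee_fin.
Qed.

End Tonelli.

Section TotalCurvature.
Context {R : realType}.
Local Notation mu := (@lebesgue_measure R).

(** The secant of [position_angle q y]; it is the parameter [h] at which the direction of the other
    curve is taken. *)
Definition radial_factor (q : seq R) (y : R) :=
  Num.sqrt (expsum q 0 y * expsum q 2 y / gram q y).

Section Pair.
Variables (p q : seq R) (tp bp tq bq : R).
Hypothesis domp : dominant_in p tp bp.
Hypothesis domq : dominant_in q tq bq.
Hypothesis sq : sorted >=%R q.

Let D0 := dominant_gram_gt0 _ _ _ domp.
Let E0 := dominant_gram_gt0 _ _ _ domq.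
Let a0 := dominant_expsum0_gt0 _ _ _ domp.
Let b0 := dominant_expsum0_gt0 _ _ _ domq.
Let b2 := dominant_expsum2_gt0 _ _ _ domq.

Lemma radial_factor_ge1 y : 1 <= radial_factor q y.
Proof.
have := @ler_wsqrtr R 1 (expsum q 0 y * expsum q 2 y / gram q y).
rewrite sqrtr1; apply; rewrite ler_pdivlMr // mul1r /gram.
by rewrite gerBl sqr_ge0.
Qed.

Lemma hessian_det_gram x y : hessian_det (expsum p) (expsum q) x y =
  gram p x * (expsum q 0 y * expsum q 2 y) + expsum p 1 x ^+ 2 * gram q y.
Proof. by rewrite /hessian_det /gram; ring. Qed.

Lemma hessian_det_gt0 x y : 0 < hessian_det (expsum p) (expsum q) x y.
Proof.
rewrite hessian_det_gram ltr_pwDl ?mulr_gt0 //.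
by rewrite mulr_ge0 ?sqr_ge0 // ltW.
Qed.

Definition curvature_part x y :=
  expsum q 1 y * dgram q y * (2 * expsum p 2 x * gram p x - expsum p 1 x * dgram p x)
  / (8 * Num.sqrt (hessian_det (expsum p) (expsum q) x y) ^+ 3).

(** With [h = radial_factor q y], [hessian_det] is [gram q y] times the squared
    [direction_radius p h x]. The variable [x] then enters only through [ddirection], whose total
    variation is bounded independently of [h]. *)
Lemma normr_curvature_part x y : `|curvature_part x y| =
  2^-1 * `|turning q y| * `|ddirection p (radial_factor q y) x|.
Proof.
set h := radial_factor q y; set Q := hessian_det (expsum p) (expsum q) x y.
have Q0 : 0 < Q by exact: hessian_det_gt0.
have h2 : h ^+ 2 = expsum q 0 y * expsum q 2 y / gram q y.
  by rewrite sqr_sqrtr // divr_ge0 ?mulr_ge0 // ltW.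
have rE : direction_radius p h x = Num.sqrt Q / Num.sqrt (gram q y).
  rewrite /direction_radius -sqrtrV ?ltW // -sqrtrM ?ltW //; congr Num.sqrt.
  rewrite h2 /Q hessian_det_gram; field; exact: lt0r_neq0.
rewrite /curvature_part /turning /ddirection rE h2.
set e := Num.sqrt (gram q y); set w := Num.sqrt Q.
have e0 : 0 < e by rewrite sqrtr_gt0.
have w0 : 0 < w by rewrite sqrtr_gt0.
have ee : gram q y = e ^+ 2 by rewrite sqr_sqrtr // ltW.
rewrite ee; set N := _ - _; set B := expsum q 1 y * dgram q y.
have n1 := lt0r_neq0 (b0 y); have n2 := lt0r_neq0 (b2 y).
have n3 := lt0r_neq0 e0; have n4 := lt0r_neq0 w0.
rewrite -{1}(@ger0_norm _ (2^-1)) // -!normrM; congr `|_|.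
by field; rewrite n1 n2 n3 n4.
Qed.

Lemma measurable_fun_inv (d : measure_display) (T : measurableType d) (f : T -> R) :
  (forall t, 0 < f t) -> measurable_fun setT f ->
  measurable_fun setT (fun t => (f t)^-1).
Proof.
move=> f0 mf.
(* Positivity lets the inverse be written with measurable functions only. *)
have -> : (fun t => (f t)^-1) = expR \o (fun t => - ln (f t)).
  by apply/funext => t /=; rewrite expRN lnK // posrE.
apply: measurableT_comp; first exact: measurable_expR.
by apply: measurable_funN; apply: measurableT_comp => //; exact: measurable_ln.
Qed.

Lemma measurable_curvature_part (d : measure_display) (T : measurableType d)
    (f g : T -> R) : measurable_fun setT f -> measurable_fun setT g ->
  measurable_fun setT (fun t => curvature_part (f t) (g t)).
Proof.
move=> mf mg.
have m1 (h : R -> R) : continuous h -> measurable_fun setT (fun t => h (f t)).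
  by move=> /continuous_measurable_fun mh; exact: (measurableT_comp mh mf).
have m2 (h : R -> R) : continuous h -> measurable_fun setT (fun t => h (g t)).
  by move=> /continuous_measurable_fun mh; exact: (measurableT_comp mh mg).
have ce := @continuous_expsum R; have cg := @continuous_gram R.
have cd := @continuous_dgram R.
have mQ : measurable_fun setT (fun t => hessian_det (expsum p) (expsum q) (f t) (g t)).
  under eq_fun do rewrite hessian_det_gram.
  apply: measurable_funD; apply: measurable_funM.
  - exact: m1.
  - by apply: (m2 (fun y => expsum q 0 y * expsum q 2 y)); exact: continuous_mul.
  - by apply: (m1 (fun x => expsum p 1 x ^+ 2)); exact: continuous_pow.
  - exact: m2.
apply: measurable_funM.
  apply: measurable_funM.
    by apply: (m2 (fun y => expsum q 1 y * dgram q y)); exact: continuous_mul.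
  apply: (m1 (fun x => 2 * expsum p 2 x * gram p x - expsum p 1 x * dgram p x)).
  apply: continuous_add; last by apply: continuous_opp; exact: continuous_mul.
  by apply: continuous_mul => //; apply: continuous_mul => //; exact: continuous_cst1.
apply: measurable_fun_inv.
  by move=> t; rewrite mulr_gt0 // exprn_gt0 // sqrtr_gt0 hessian_det_gt0.
apply: measurable_funM => //; apply: measurable_funX.
apply: (measurableT_comp _ mQ); apply: continuous_measurable_fun.
exact: sqrt_continuous.
Qed.

Let N : R := (size p)%:R - 1 + ln (size p)%:R.
Let B : R := ((size q)%:R - 1) * pi.

Lemma curvature_part_iterated (m : measurable_fun setT
    (fun y => \int[mu]_x `|curvature_part x y|%:E)%E) :
  (\int[mu]_y \int[mu]_x `|curvature_part x y|%:E <= (N * B)%:E)%E.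
Proof.
have np : 1 <= (size p)%:R :> R.
  by rewrite ler1n; case: domp; case: (p).
have -> : N * B = (2 * N) * (2^-1 * B) by field.
have E y x : `|curvature_part x y| = (2^-1 * `|turning q y|) * `|ddirection p (radial_factor q y) x|.
  exact: normr_curvature_part.
under eq_integral do under eq_integral do rewrite E.
apply: (iterated_integral_le (fun y => 2^-1 * `|turning q y|)
  (fun y x => `|ddirection p (radial_factor q y) x|)) => //.
- rewrite mulr_ge0 // /N addr_ge0 ?subr_ge0 //; exact: ln_ge0.
- apply: continuous_measurable_fun; apply: continuous_mul; first exact: continuous_cst1.
  by apply: continuous_norm; exact: continuous_turning domq.
- move=> u; apply: continuous_measurable_fun; apply: continuous_norm.
  exact: continuous_ddirection domp (radial_factor_ge1 u).
- by under eq_fun do under eq_integral do rewrite -E.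
- by move=> u; exact: direction_variation domp (radial_factor_ge1 u).
- under eq_integral do rewrite EFinM.
  rewrite ge0_integralZl_EFin //; last first.
    apply/measurable_EFinP; apply: continuous_measurable_fun.
    by apply: continuous_norm; exact: continuous_turning domq.
  rewrite EFinM lee_wpmul2l //; exact: turning_integral domq sq.
Qed.

End Pair.

Lemma hessian_det_swap (p q : seq R) x y :
  hessian_det (expsum q) (expsum p) y x = hessian_det (expsum p) (expsum q) x y.
Proof. by rewrite /hessian_det; ring. Qed.

Section Bound.
Variables (p q : seq R) (tp bp tq bq : R).
Hypothesis domp : dominant_in p tp bp.
Hypothesis domq : dominant_in q tq bq.
Hypothesis sp : sorted >=%R p.
Hypothesis sq : sorted >=%R q.

Lemma total_density_product_hessian (t : R * R) :
  let G := product_hessian (expsum p) (expsum q) in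
  `|gauss_curvature G t| * vol_density G t =
  `|curvature_part p q t.1 t.2 + curvature_part q p t.2 t.1|.
Proof.
have Q0 := hessian_det_gt0 _ _ _ _ _ _ domp domq.
have K := gauss_curvature_product_hessian _ _ (is_derive_expsum p) (is_derive_expsum q) Q0 t.
rewrite /= K (vol_density_product_hessian _ _ Q0) {K}.
rewrite /product_curvature /curvature_part (hessian_det_swap p q).
rewrite -/(gram p t.1) -/(gram q t.2) -/(dgram p t.1) -/(dgram q t.2).
have w0 : 0 < Num.sqrt (hessian_det (expsum p) (expsum q) t.1 t.2) by rewrite sqrtr_gt0.
have := sqr_sqrtr (ltW (Q0 t.1 t.2)); move: (Num.sqrt _) w0 => w w0 <-.
rewrite -[X in _ * X]ger0_norm ?divr_ge0 ?(ltW w0) // -normrM -normrN.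
by congr `|_|; have := lt0r_neq0 w0 => n0; field.
Qed.

Lemma total_abs_curvature_product_hessian :
  (\int[mu \x mu]_t (`|gauss_curvature (product_hessian (expsum p) (expsum q)) t|
     * vol_density (product_hessian (expsum p) (expsum q)) t)%:E <=
   (((size p)%:R - 1 + ln (size p)%:R) * (((size q)%:R - 1) * pi)
   + ((size q)%:R - 1 + ln (size q)%:R) * (((size p)%:R - 1) * pi))%:E)%E.
Proof.
under eq_integral do rewrite total_density_product_hessian.
pose c1 (t : R * R) := `|curvature_part p q t.1 t.2|.
pose c2 (t : R * R) := `|curvature_part q p t.2 t.1|.
have f1 := @measurable_fst _ _ R R; have f2 := @measurable_snd _ _ R R.
have m1 : measurable_fun setT c1.
  by apply: measurableT_comp => //; exact: (measurable_curvature_part _ _ _ _ _ _ domp domq).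
have m2 : measurable_fun setT c2.
  by apply: measurableT_comp => //; exact: (measurable_curvature_part _ _ _ _ _ _ domq domp).
apply: (@le_trans _ _ (\int[mu \x mu]_t ((c1 t)%:E + (c2 t)%:E))%E).
  apply: ge0_le_integral => //.
  - apply/measurable_EFinP; apply: measurableT_comp => //; apply: measurable_funD.
      exact: (measurable_curvature_part _ _ _ _ _ _ domp domq).
    exact: (measurable_curvature_part _ _ _ _ _ _ domq domp).
  - by apply: emeasurable_funD; exact/measurable_EFinP.
  - by move=> t _; rewrite -EFinD lee_fin ler_normD.
have c10 t : (0 <= (c1 t)%:E)%E by rewrite lee_fin /c1.
have c20 t : (0 <= (c2 t)%:E)%E by rewrite lee_fin /c2.
have e1 : measurable_fun setT (fun t => (c1 t)%:E) by exact/measurable_EFinP.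
have e2 : measurable_fun setT (fun t => (c2 t)%:E) by exact/measurable_EFinP.
(* Each half is integrated first in the variable of its [ddirection] factor: [x] here, [y] in
   [F2]. *)
have F1 : (\int[mu \x mu]_t (c1 t)%:E = \int[mu]_y \int[mu]_x (c1 (x, y))%:E)%E.
  rewrite -(@fubini_tonelli _ _ (measurableTypeR R) (measurableTypeR R) R mu mu
    (fun t => (c1 t)%:E) e1 c10).
  exact: fubini_tonelli1.
have F2 : (\int[mu \x mu]_t (c2 t)%:E = \int[mu]_x \int[mu]_y (c2 (x, y))%:E)%E.
  exact: fubini_tonelli1.
rewrite ge0_integralD // F1 F2 EFinD leeD //.
- apply: (curvature_part_iterated _ _ _ _ _ _ domp domq sq).
  exact: (@measurable_fun_fubini_tonelli_G _ _ (measurableTypeR R) (measurableTypeR R)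
    R mu (fun t => (c1 t)%:E) e1 c10).
- apply: (curvature_part_iterated _ _ _ _ _ _ domq domp sp).
  exact: (@measurable_fun_fubini_tonelli_F _ _ (measurableTypeR R) (measurableTypeR R)
    R mu (fun t => (c2 t)%:E) e2 c20).
Qed.

End Bound.

Lemma dominant_in_doubled (n : nat) (r : n.-tuple R) : (2 <= n)%N ->
  sorted >%R r -> real_roots_dominant r ->
  dominant_in (doubled n r) (2 * r`_0) (2 * r`_n.-1) /\ sorted >=%R (doubled n r).
Proof.
move=> n2 sr [r0 rn].
have sr' : sorted >=%R r by apply: sub_sorted sr => x y /= /ltW.
have tr : transitive (>=%R : rel R) by move=> a b c ba cb; exact: le_trans cb ba.
have nth_in i : (i < n)%N -> r`_i \in (r : seq R) by move=> h; rewrite mem_nth // size_tuple.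
have n0 : (0 < n)%N by exact: ltnW.
have nn : (n.-1 < n)%N by rewrite prednK.
split; first split.
- by rewrite map_f // nth_in.
- by rewrite map_f // nth_in.
- by rewrite pmulr_rlt0 // rn pmulr_rgt0.
- move=> l /mapP[x xr ->]; rewrite !ler_pM2l //.
  have ir : (index x r < n)%N by rewrite -{2}(size_tuple r) index_mem.
  rewrite -(nth_index 0 xr).
  have mono := sorted_leq_nth tr (fun x => lexx x) 0 sr'.
  apply/andP; split; apply: mono; rewrite ?inE ?size_tuple //.
  by rewrite -ltnS prednK.
- rewrite sorted_map; apply: sub_sorted sr' => x y /=.
  by rewrite ler_pM2l.
Qed.

End TotalCurvature.

Theorem theorem1p13 (R : realType) (n1 n2 : nat)
  (hn1 : (2 <= n1)%N) (hn2 : (2 <= n2)%N)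
  (P1 : diffop R n1) (P2 : diffop R n2)
  (hreal1 : roots_real (charpoly P1)) (hreal2 : roots_real (charpoly P2))
  (hsimple1 : roots_simple (charpoly P1))
  (hsimple2 : roots_simple (charpoly P2))
  (r : n1.-tuple R) (s : n2.-tuple R)
  (hr : decreasing_listing (charpoly P1) r)
  (hs : decreasing_listing (charpoly P2) s)
  (hdom1 : real_roots_dominant r) (hdom2 : real_roots_dominant s) :
  (total_abs_curvature (tensor_surface r s) <=
   (2 * pi + 4 * n1%:R * (n1%:R - 1) + 4 * n2%:R * (n2%:R - 1))%:E)%E.
Proof.
have [dr sr] := dominant_in_doubled _ _ hn1 hr.1 hdom1.
have [ds ss] := dominant_in_doubled _ _ hn2 hs.1 hdom2.
rewrite /total_abs_curvature induced_metric_tensor_surface.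
apply: (le_trans (total_abs_curvature_product_hessian _ _ _ _ _ _ dr ds sr ss)).
by rewrite !size_map !size_tuple lee_fin numeric_bound.
Qed.
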